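(* (a) Let $K$ be an algebraic number field and let $n\ge 3$ and $d\ge 1$ be integers. Then there exist irreducible polynomials $f(x)\in K[x]$ of degree $nd$ whose root clusters have size $d$. (b) Let $d$ be an even positive integer. Then there exist irreducible polynomials in $\mathbf{Q}[x]$ of degree $2d$ whose root clusters have size $d$.
   Context: For an irreducible polynomial $h(x)$ over a field $K$ of characteristic $0$ and a root $\gamma$ of $h$ in a fixed algebraic closure $\bar K$, the root cluster of $\gamma$ is the set of roots of $h$ lying in the field $K(\gamma)$; its cardinality is the root cluster size of $\gamma$ (it is the same for every root of $h$). *)

(* Defs.v *)
From mathcomp Require Import all_boot all_order all_algebra all_field.
From mathcomp Require Import boolp classical_sets functions cardinality.

Set Implicit Arguments.
Unset Strict Implicit.
Unset Printing Implicit Defensive.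

Import GRing.Theory.
Local Open Scope classical_set_scope.
Local Open Scope card_scope.
Local Open Scope ring_scope.

(* An algebraic closure of K is an algebraically closed field Kbar together
   with an embedding iota over which every element of Kbar is algebraic. *)
Definition algebraic_closure (K : fieldType) (Kbar : closedFieldType)
    (iota : {rmorphism K -> Kbar}) : Prop :=
  forall x : Kbar, algebraicOver iota x.

(* K(gamma), as the set of values at gamma of rational functions over K whose
   denominator does not vanish at gamma; Kbar need not be finite-dimensional
   over K, so the {subfield _} adjunction <<K; gamma>> is not available. *)
Definition simple_extension (K : fieldType) (Kbar : closedFieldType)
    (iota : {rmorphism K -> Kbar}) (gamma : Kbar) : set Kbar :=
  [set x | exists p q : {poly K},
     (map_poly iota q).[gamma] != 0 /\
     x = (map_poly iota p).[gamma] / (map_poly iota q).[gamma]].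

Definition root_cluster (K : fieldType) (Kbar : closedFieldType)
    (iota : {rmorphism K -> Kbar}) (h : {poly K}) (gamma : Kbar) : set Kbar :=
  [set x | root (map_poly iota h) x] `&` simple_extension iota gamma.

Definition root_clusters_have_size (K : fieldType) (Kbar : closedFieldType)
    (iota : {rmorphism K -> Kbar}) (h : {poly K}) (d : nat) : Prop :=
  forall gamma : Kbar, root (map_poly iota h) gamma ->
    root_cluster iota h gamma #= `I_d.

(* Main.v *)
(* Let M/K be Galois of degree m, let M lie in L, and let g be a polynomial over
   Q that is irreducible over L and such that a root z of g has exactly t
   conjugates in L(z).  Then f, the product of the translates g(X - b) over the
   conjugates b of a generator of M, is irreducible over K of degree m deg g,
   and the roots of f in K(b + z) are the sums of one of the m conjugates of b
   and one of the t conjugates of z, whence clusters of size m t.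

   The field M is found inside L = K(zeta_N): the group Gal(L/K) is abelian and
   [L : K] is divisible by m for suitable N.

   The polynomial g is X^n - l X^(n-1) + q l (with t = 1) for (a), and
   X^4 - l^2 X^2 + q l (with t = 2) for (b), where q and l are primes such that
   the number field L embeds into Q_q and Q_l.  It is Eisenstein at l, hence
   irreducible over L.  At q it has the simple roots l (resp. l and -l) modulo
   q, whereas its other roots have fractional valuation; so exactly one (resp.
   two) of its roots lie in Q_q.  The fields Q_q and Q_l are not constructed:
   identities over L are lifted to polynomials over Q[y] and evaluated at
   Hensel approximations y = r of a root of a polynomial defining L. *)
From HB Require Import structures.
Require Import Defs.
From mathcomp Require Import all_boot all_order all_algebra all_field.
From mathcomp Require Import all_fingroup all_solvable.
From mathcomp Require Import boolp classical_sets functions cardinality.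
From mathcomp Require Import ring zify.

Set Implicit Arguments.
Unset Strict Implicit.
Unset Printing Implicit Defensive.

Import Order.TTheory GRing.Theory Num.Theory.
Local Open Scope ring_scope.

Local Notation "p ^Q" := (map_poly (intr : int -> rat) p) (at level 2, format "p ^Q").

(** * Simple roots modulo primes *)

Lemma Euclid_dvdzM (q : nat) (a b : int) : prime q ->
  (q %| a * b)%Z = (q %| a)%Z || (q %| b)%Z.
Proof. by move=> q_pr; rewrite !dvdzE abszM absz_nat Euclid_dvdM. Qed.

Lemma Euclid_dvdzX (q : nat) (a : int) k : prime q ->
  (q %| a ^+ k)%Z -> (q %| a)%Z.
Proof. by move=> q_pr; rewrite !dvdzE abszX absz_nat Euclid_dvdX // => /andP[]. Qed.

Lemma coprimez_prime (q : nat) k (c : int) : prime q -> ~~ (q %| c)%Z ->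
  coprimez (q%:Z ^+ k) c.
Proof.
move=> q_pr qc; rewrite coprimezE abszX absz_nat; apply: coprimeXl.
by rewrite prime_coprime.
Qed.

Lemma horner_addX2 (R : comNzRingType) (p : {poly R}) x h :
  exists u, p.[x + h] = p.[x] + h * p^`().[x] + h ^+ 2 * u.
Proof.
elim/poly_ind: p => [|p c [u IH]].
  by exists 0; rewrite deriv0 !horner0; ring.
rewrite !hornerMXaddC IH derivMXaddC !hornerE.
by exists (u * (x + h) + p^`().[x]); ring.
Qed.

Lemma horner_sub (R : comNzRingType) (p : {poly R}) x y :
  exists u, p.[x] - p.[y] = (x - y) * u.
Proof.
have [u Du] := horner_addX2 p y (x - y).
exists (p^`().[y] + (x - y) * u); rewrite addrC subrK in Du; rewrite Du; ring.
Qed.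

Definition simple_root_mod (q : nat) (p : {poly int}) (r : int) :=
  (q %| p.[r])%Z /\ ~~ (q %| p^`().[r])%Z.

(** Newton's iteration with a fixed inverse [v] of p'(r) modulo [q] in place of 1/p'(s). All
    iterates stay congruent to [r], so v p'(s) remains 1 modulo [q] and each step gains a factor
    [q]. *)
Lemma hensel (q : nat) (p : {poly int}) (r : int) :
  prime q -> simple_root_mod q p r ->
  forall k, exists s, (q %| s - r)%Z /\ (q%:Z ^+ k %| p.[s])%Z.
Proof.
move=> q_pr [q_r q'r].
have /coprimezP[[u v] /= Euv]: coprimez q (p^`().[r]).
  by have := coprimez_prime 1 q_pr q'r.
suff H k : exists s, (q %| s - r)%Z /\ (q%:Z ^+ k.+1 %| p.[s])%Z.
  by case=> [|k]; [exists r; rewrite subrr dvdz0 expr0 dvd1z|exact: H].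
elim: k => [|k [s [s_r /dvdzP[m Dm]]]]; first by exists r; rewrite subrr dvdz0 expr1.
exists (s - v * p.[s]); split.
  rewrite addrAC rpredB // dvdz_mull // Dm dvdz_mull // exprS dvdz_mulr //.
have [w ->] := horner_addX2 p s (- (v * p.[s])).
have [w' Dw'] := horner_sub p^`() s r.
have {Dw'} Ds : p^`().[s] = p^`().[r] + (s - r) * w' by rewrite -Dw' addrC subrK.
have /dvdzP[t Dt] := s_r.
have -> : p.[s] + - (v * p.[s]) * p^`().[s] + (- (v * p.[s])) ^+ 2 * w =
  p.[s] * (q%:Z * (u - v * t * w') + p.[s] * v ^+ 2 * w).
  have -> : q%:Z * (u - v * t * w') = 1 - v * p^`().[s].
    by rewrite Ds Dt -Euv; ring.
  by ring.
have q_ps : (q%:Z ^+ k.+1 %| p.[s])%Z by rewrite Dm dvdz_mull.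
rewrite [q%:Z ^+ k.+2]exprSr dvdz_mul // rpredD ?dvdz_mulr //.
by apply: dvdz_trans q_ps; rewrite exprS dvdz_mulr.
Qed.

(** A prime at most [B] divides B!, hence cannot divide a number that is 1 modulo B!. So any prime
    factor of [u] will do. *)
Lemma prime_gt_dvdz (B : nat) (u : int) : (1 < `|u|)%N -> (u == 1 %[mod B`!])%Z ->
  exists q : nat, [/\ prime q, (B < q)%N & (q %| u)%Z].
Proof.
move=> u1 uB; exists (pdiv `|u|); split; first exact: pdiv_prime.
  rewrite ltnNge; apply/negP => le_qB.
  have qu : (pdiv `|u| %| u)%Z by rewrite dvdzE pdiv_dvd.
  have : ((pdiv `|u|)%:Z %| (1 - u)%R + u)%Z.
    rewrite rpredD //.
    have /dvdz_trans -> //: ((pdiv `|u|)%:Z %| (B`!)%:Z)%Z.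
      by rewrite dvdzE !absz_nat dvdn_fact // pdiv_gt0.
    by rewrite -eqz_mod_dvd eq_sym.
  rewrite subrK dvdz1 absz_nat => /eqP E; have := pdiv_prime u1; by rewrite E.
by rewrite dvdzE pdiv_dvd.
Qed.

(** A value violating one of the conditions comes from a root of the nonzero polynomial [w], which
    has fewer than [size w] roots. With e = p(0), the conditions keep the quotient of the value by
    p(0) away from 0, 1 and -1, so that it can have a prime factor. *)
Lemma exists_horner_big (p : {poly int}) (c : int) : (1 < size p)%N -> c != 0 ->
  forall e : int, exists t : nat,
    p.[c * t%:Z] != 0 /\ p.[c * t%:Z] != e /\ p.[c * t%:Z] != - e.
Proof.
move=> sp c0 e.
pose w := p * (p - e%:P) * (p + e%:P).
have sz x : size (p + x%:P) = size p.
  by rewrite size_polyDl // size_polyC; case: eqP => //= _; rewrite (ltnW sp).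
have w0 : w != 0.
  have nz x : p + x%:P != 0 by rewrite -size_poly_gt0 sz (ltn_trans _ sp).
  by rewrite !mulf_neq0 // -?polyCN ?nz // -size_poly_gt0 (ltn_trans _ sp).
have [t Ht] : exists t : nat, ~~ root w (c * t%:Z).
  pose s := [seq c * t%:Z | t : 'I_(size w)].
  have us : uniq s.
    by rewrite map_inj_uniq ?enum_uniq // => x y /(mulfI c0) [] /val_inj.
  case: (boolP (all (root w) s)) => [al|].
    by have := max_poly_roots w0 al us; rewrite size_map size_enum_ord ltnn.
  by case/allPn => x /mapP[t _ ->] Ht; exists t.
exists t; move: Ht; rewrite /root /w !hornerE !mulf_eq0 !negb_or.
by rewrite subr_eq0 addr_eq0 => /andP[/andP[-> ->] ->].
Qed.

(* Euclid's argument applied to the values of p at the multiples of p(0) B!. *)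
Lemma exists_prime_dvd_horner (p : {poly int}) (B : nat) : (1 < size p)%N ->
  exists (q : nat) (r : int), [/\ prime q, (B < q)%N & (q %| p.[r])%Z].
Proof.
move=> sp; have [p0|p0] := eqVneq p.[0] 0.
  (* When p(0) = 0, the point 0 serves for every prime; a prime factor of B! + 1 exceeds [B]. *)
  exists (pdiv B`!.+1), 0; rewrite p0 dvdz0.
  have pr : prime (pdiv B`!.+1) by rewrite pdiv_prime // ltnS fact_gt0.
  split => //; rewrite ltnNge; apply/negP => le_qB.
  have := pdiv_dvd B`!.+1; rewrite -addn1 dvdn_addr.
    by rewrite dvdn1 addn1 => /eqP E; move: pr; rewrite E.
  by rewrite addn1 dvdn_fact // pdiv_gt0.
have c0 : p.[0] * (B`!)%:Z != 0.
  by rewrite mulf_neq0 // eqz_nat -lt0n fact_gt0.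
have [t [H0 [H1 H2]]] := exists_horner_big sp c0 p.[0].
have [u Du] := horner_sub p (p.[0] * (B`!)%:Z * t%:Z) 0.
set r := p.[0] * (B`!)%:Z * t%:Z in H0 H1 H2 Du.
have Dr : p.[r] = p.[0] * (1 + (B`!)%:Z * (t%:Z * u)).
  by rewrite -[p.[r]](subrK p.[0]) Du /r; ring.
have [||q [q_pr Bq qd]] := @prime_gt_dvdz B (1 + (B`!)%:Z * (t%:Z * u)).
- move: H0 H1 H2; rewrite Dr; set v := 1 + _.
  rewrite mulf_eq0 negb_or => /andP[_ v0].
  rewrite -{2}[p.[0]]mulr1 (inj_eq (mulfI p0)) -mulrN1 (inj_eq (mulfI p0)).
  by move: v v0; clear; lia.
- by rewrite eqz_mod_dvd addrC addrA addNr add0r dvdz_mulr.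
by exists q, r; rewrite Dr dvdz_mull.
Qed.

(** Clearing denominators in a Bezout relation between p and p' yields an integral combination equal
    to the constant [a * b]. A prime larger than |a b| therefore cannot divide both p(r) and
    p'(r). *)
Lemma exists_simple_root_mod (p : {poly int}) (B : nat) : (1 < size p)%N ->
  coprimep (map_poly intr p : {poly rat}) (map_poly intr p)^`() ->
  exists (q : nat) (r : int), [/\ prime q, (B < q)%N & simple_root_mod q p r].
Proof.
move=> sp /Bezout_eq1_coprimepP[[u v] /= Euv].
have [u' [a a0 Du]] := rat_poly_scale u.
have [v' [b b0 Dv]] := rat_poly_scale v.
have E : b *: u' * p + a *: v' * p^`() = (a * b)%:P.
  apply: (map_inj_poly (@intr_inj rat) (rmorph0 _)).
  have -> : map_poly intr (a * b)%:P =
      (a%:~R * b%:~R) *: (u * map_poly intr p + v * (map_poly intr p)^`()).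
    by rewrite Euv alg_polyC map_polyC /= intrM.
  rewrite rmorphD /= !rmorphM /= !map_polyZ /= -deriv_map.
  rewrite Du Dv -!scalerAl scalerDr !scalerA.
  congr (_ *: _ + _ *: _).
  - by rewrite mulrAC divff ?intr_eq0 // mul1r.
  - by rewrite -mulrA divff ?intr_eq0 // mulr1.
have [q [r [q_pr Bq qd]]] := exists_prime_dvd_horner (B + `|a * b|) sp.
exists q, r; split=> //; first by apply: leq_ltn_trans Bq; rewrite leq_addr.
split=> //; apply/negP => qd'.
have : (q %| a * b)%Z.
  have := congr1 (fun x => x.[r]) E; rewrite !hornerE => <-.
  by rewrite rpredD // dvdz_mull.
rewrite dvdzE absz_nat => /dvdn_leq; rewrite absz_gt0 mulf_neq0 // => /(_ isT).
by rewrite leqNgt (leq_ltn_trans _ Bq) // leq_addl.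
Qed.

(** * q-adic valuation of rational numbers *)

(* The q-adic valuation of x is at least k. *)
Definition padic_ge (q k : nat) (x : rat) :=
  exists c a : int, ~~ (q %| c)%Z /\ c%:~R * x = (q%:Z ^+ k * a)%:~R.

Section Padic.
Variable q : nat.
Hypothesis q_pr : prime q.

Let q_neq0 : q%:Z != 0. Proof. by rewrite eqz_nat -lt0n prime_gt0. Qed.

Let ndvdM c c' : ~~ (q %| c)%Z -> ~~ (q %| c')%Z -> ~~ (q %| c * c')%Z.
Proof. by rewrite Euclid_dvdzM // negb_or => -> ->. Qed.

Lemma padic_ge_int k a : (q%:Z ^+ k %| a)%Z -> padic_ge q k a%:~R.
Proof.
move=> /dvdzP[b ->]; exists 1, b; rewrite mul1r mulrC; split=> //.
by rewrite dvdz1 absz_nat; case: q q_pr => [|[]].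
Qed.

Lemma padic_ge_intP k a : padic_ge q k a%:~R -> (q%:Z ^+ k %| a)%Z.
Proof.
move=> [c [b [qc]]]; rewrite -intrM => /intr_inj E.
by rewrite -(@Gauss_dvdzr _ c) ?E ?dvdz_mulr // coprimez_prime.
Qed.

Lemma padic_ge_le j k x : (j <= k)%N -> padic_ge q k x -> padic_ge q j x.
Proof.
move=> le_jk [c [a [qc E]]]; exists c, (q%:Z ^+ (k - j) * a).
by rewrite mulrA -exprD subnKC.
Qed.

Lemma padic_geM j k x y : padic_ge q j x -> padic_ge q k y -> padic_ge q (j + k) (x * y).
Proof.
move=> [c [a [qc E]]] [c' [a' [qc' E']]]; exists (c * c'), (a * a'); split.
  exact: ndvdM.
by rewrite intrM mulrACA E E' -intrM exprD mulrACA.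
Qed.

Lemma padic_geMl k x y : padic_ge q 0 x -> padic_ge q k y -> padic_ge q k (x * y).
Proof. exact: padic_geM. Qed.

Lemma padic_geMr k x y : padic_ge q k x -> padic_ge q 0 y -> padic_ge q k (x * y).
Proof. by rewrite mulrC => *; apply: padic_geMl. Qed.

Lemma padic_geD k x y : padic_ge q k x -> padic_ge q k y -> padic_ge q k (x + y).
Proof.
move=> [c [a [qc E]]] [c' [a' [qc' E']]].
exists (c * c'), (a * c' + a' * c); split; first exact: ndvdM.
rewrite intrM mulrDr [X in X + _]mulrAC E -mulrA E' -!intrM -intrD; congr _%:~R.
by ring.
Qed.

Lemma padic_ge_int0 a : padic_ge q 0 a%:~R.
Proof. by apply: padic_ge_int; rewrite expr0 dvd1z. Qed.

Lemma padic_ge0 k : padic_ge q k 0.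
Proof. by rewrite -[0]/(0%:~R); apply: padic_ge_int; rewrite dvdz0. Qed.

Lemma padic_geN k x : padic_ge q k x -> padic_ge q k (- x).
Proof. by move=> x_k; rewrite -mulN1r -(intrN _ 1); apply: padic_geMl (padic_ge_int0 _) _. Qed.

Lemma padic_geB k x y : padic_ge q k x -> padic_ge q k y -> padic_ge q k (x - y).
Proof. by move=> x_k y_k; apply/padic_geD/padic_geN. Qed.

Lemma padic_geX k x : padic_ge q 0 x -> padic_ge q 0 (x ^+ k).
Proof.
move=> x0; elim: k => [|k IH]; first exact: (padic_ge_int0 1).
by rewrite exprS; apply: padic_geMl.
Qed.

(* A q-integral number outside the maximal ideal is a unit. *)
Lemma padic_ge_unit y : padic_ge q 0 y -> padic_ge q 1 y \/
  forall k x, padic_ge q k (x * y) -> padic_ge q k x.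
Proof.
move=> [c [a [qc]]]; rewrite expr0 mul1r => E.
have [/dvdzP[b Db]|qa] := boolP (q %| a)%Z.
  by left; exists c, b; rewrite E Db mulrC.
right=> k x [c' [b [qc' E']]]; exists (c' * a), (b * c); split; first exact: ndvdM.
transitivity (c%:~R * (c'%:~R * (x * y))); first by rewrite intrM -E; ring.
by rewrite E' -intrM; congr _%:~R; ring.
Qed.

Lemma padic_ge_prime x y : padic_ge q 0 y -> padic_ge q 1 (x * y) ->
  padic_ge q 1 x \/ padic_ge q 1 y.
Proof. by move=> /padic_ge_unit[|u /u]; [right|left]. Qed.

Lemma padic_ge_horner (p : {poly int}) t : padic_ge q 0 t -> padic_ge q 0 p^Q.[t].
Proof.
move=> t0; elim/poly_ind: p => [|p c IH].
  by rewrite rmorph0 horner0; apply: (padic_ge_int0 0).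
rewrite rmorphD rmorphM /= map_polyX map_polyC hornerMXaddC.
by apply: padic_geD (padic_ge_int0 c); apply: padic_geMl.
Qed.

(** The rational root argument: multiply p(t) by the power of the denominator of [t] of exponent deg
    p. If [q] divided this denominator, only the leading term, a power of the numerator, could
    survive modulo [q], and it would have to vanish. *)
Lemma padic_ge0_monic (p : {poly int}) t : p \is monic -> (1 < size p)%N ->
  padic_ge q 0 p^Q.[t] -> padic_ge q 0 t.
Proof.
move=> p_mon sp [c [m [qc]]]; rewrite expr0 mul1r => E.
have Dt : (denq t)%:~R * t = (numq t)%:~R by rewrite mulrC -numqE.
have [qd|qd] := boolP (q %| denq t)%Z; last first.
  by exists (denq t), (numq t); rewrite expr0 mul1r.
have q_num : ~~ (q %| numq t)%Z.
  apply/negP => qn; have := coprime_num_den t => /eqP Eg.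
  have : (q %| gcdn `|numq t| `|denq t|)%N.
    by rewrite dvdn_gcd; move: qn qd; rewrite !dvdzE absz_nat => -> ->.
  by rewrite Eg dvdn1 => /eqP q1; move: q_pr; rewrite q1.
have [n Dn] : exists n, size p = n.+2 by case: (size p) sp => [|[|n]] // _; exists n.
have [w Dw] : exists w : int,
    (denq t)%:~R ^+ n.+1 * p^Q.[t] = (numq t ^+ n.+1 + denq t * w)%:~R.
  exists (\sum_(i < n.+1) p`_i * numq t ^+ i * denq t ^+ (n - i)).
  rewrite horner_coef size_map_inj_poly ?rmorph0 //; last exact: intr_inj.
  rewrite Dn big_ord_recr /= mulrDr addrC rmorphD /= !rmorphM /=; congr (_ + _).
    rewrite coef_map /= -[n.+1]/(n.+2.-1) -Dn -lead_coefE (monicP p_mon) mul1r.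
    by rewrite -exprMn Dt rmorphXn.
  rewrite !mulr_sumr rmorph_sum /= mulr_sumr; apply: eq_bigr => i _.
  rewrite coef_map /= !rmorphM /= !rmorphXn /= -Dt exprMn.
  have -> : (denq t)%:~R ^+ n.+1 =
      (denq t)%:~R * (denq t)%:~R ^+ i * (denq t)%:~R ^+ (n - i) :> rat.
    by rewrite -mulrA -exprD -exprS subnKC // -ltnS.
  by ring.
have /intr_inj H : (c * (numq t ^+ n.+1 + denq t * w))%:~R =
    (denq t ^+ n.+1 * m)%:~R :> rat.
  by rewrite intrM -Dw mulrCA E rmorphM rmorphXn.
have : (q %| c * numq t ^+ n.+1)%Z.
  have -> : c * numq t ^+ n.+1 = denq t ^+ n.+1 * m - c * (denq t * w).
    by rewrite -H; ring.
  apply: rpredB; first by rewrite dvdz_mulr // dvdz_exp.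
  by rewrite dvdz_mull // dvdz_mulr.
by rewrite Euclid_dvdzM // (negPf qc) /= => /(Euclid_dvdzX q_pr); rewrite (negPf q_num).
Qed.

(** The remainder is a polynomial [u] over the integers, so its value at a q-integral [h] is again
    q-integral. *)
Lemma int_poly_taylor (p : {poly int}) (b : int) : exists u : {poly int},
  forall h : rat, p^Q.[b%:~R + h] = p.[b]%:~R + h * p^`().[b]%:~R + h ^+ 2 * u^Q.[h].
Proof.
elim/poly_ind: p => [|p c [u IH]].
  by exists 0 => h; rewrite deriv0 !rmorph0 !horner0 !rmorph0 !mulr0 !addr0.
exists (u * ('X + b%:P) + (p^`().[b])%:P) => h.
rewrite derivMXaddC !hornerE !rmorphD !rmorphM /= !map_polyX !map_polyC /= !hornerE IH.
rewrite rmorphD /= map_polyX map_polyC !hornerE /=.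
by ring.
Qed.

(** Uniqueness in Hensel's lemma: with h = t - b, the difference p(t) - p(b) is h (p'(b) + h u(h)),
    and the second factor is a q-adic unit because [q] divides h but not p'(b). *)
Lemma padic_ge_near (p : {poly int}) (b : int) j k t : ~~ (q %| p^`().[b])%Z ->
  (q%:Z ^+ k %| p.[b])%Z -> (j <= k)%N -> padic_ge q 1 (t - b%:~R) ->
  padic_ge q j p^Q.[t] -> padic_ge q j (t - b%:~R).
Proof.
move=> q'b qb le_jk tb pt; have [u Du] := int_poly_taylor p b.
have := Du (t - b%:~R); rewrite addrC subrK; set h := t - b%:~R => E.
have h0 : padic_ge q 0 h by apply: padic_ge_le tb.
have hu : padic_ge q 1 (h * u^Q.[h]) by apply: padic_geMr (padic_ge_horner _ _).
have y0 : padic_ge q 0 (p^`().[b]%:~R + h * u^Q.[h]).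
  by apply: padic_geD (padic_ge_int0 _) (padic_ge_le _ hu).
case: (padic_ge_unit y0) => [y1|]; last first.
  apply; have -> : h * (p^`().[b]%:~R + h * u^Q.[h]) = p^Q.[t] - p.[b]%:~R.
    by rewrite E; ring.
  by apply: padic_geB pt _; apply: padic_ge_int; apply: dvdz_trans qb; apply: dvdz_exp2l.
have := padic_geB y1 hu; rewrite addrK => /padic_ge_intP.
by rewrite expr1 (negPf q'b).
Qed.

End Padic.

(** * Specialization of bivariate polynomials *)

(* A polynomial in X over Q[y] is evaluated at y = r. *)
Definition spec (r : int) : {poly {poly rat}} -> {poly rat} :=
  map_poly (horner_eval (r%:~R : rat)).
HB.instance Definition _ r :=
  GRing.RMorphism.copy (spec r) (map_poly (horner_eval (r%:~R : rat))).

Lemma spec_map_polyC r (p : {poly rat}) : spec r (map_poly polyC p) = p.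
Proof.
rewrite /spec -map_poly_comp map_poly_id // => x _ /=.
by rewrite /horner_eval hornerC.
Qed.

Lemma specC r p : spec r p%:P = (p.[r%:~R])%:P.
Proof. by rewrite /spec map_polyC. Qed.

Lemma specX r : spec r 'X = 'X.
Proof. exact: map_polyX. Qed.

(** * Bounded denominators and Eisenstein's criterion at q *)

Section Denominators.
Variable q : nat.
Hypothesis q_pr : prime q.

(** The loss [N] is the exponent of [q] in a common denominator of [p]. It is uniform in [r], which
    is essential: the point of specialization is chosen later, with a precision depending on [N]. *)
Lemma padic_ge_horner_rat (p : {poly rat}) : exists N, forall k x (r : int),
  padic_ge q (N + k) x -> padic_ge q k (x * p.[r%:~R]).
Proof.
have [p' [a a0 ->]] := rat_poly_scale p.
have a_gt0 : (0 < `|a|)%N by rewrite absz_gt0.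
have := pfactor_dvdnn q `|a|; set N := logn q `|a| => /dvdnP[m Dm].
exists N => k x r [c [b [qc E]]].
have qm : ~~ (q %| m)%N.
  apply/negP => /dvdnP[m' Dm']; have : (q ^ N.+1 %| `|a|)%N.
    by rewrite Dm Dm' -mulnA -expnS dvdn_mull.
  by rewrite pfactor_dvdn // ltnn.
exists (c * m%:Z), (b * Num.sg a * p'.[r]); split.
  by rewrite Euclid_dvdzM // negb_or qc.
rewrite hornerZ -[r%:~R]/(intr r) horner_map /=.
have Da : m%:Z * q%:Z ^+ N = Num.sg a * a.
  by rewrite -abszEsg Dm PoszM -rmorphXn.
have aQ : a%:~R != 0 :> rat by rewrite intr_eq0.
transitivity ((c%:~R * x) * m%:~R * a%:~R^-1 * p'.[r]%:~R); first by rewrite intrM; ring.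
rewrite E -intrM.
have -> : q%:Z ^+ (N + k) * b * m%:Z = q%:Z ^+ k * b * Num.sg a * a.
  by rewrite -[RHS]mulrA -Da exprD; ring.
by rewrite intrM mulfK // -intrM !mulrA.
Qed.

Lemma spec_coef_bound (G : {poly {poly rat}}) : exists N, forall k x r,
  padic_ge q (N + k) x -> forall i, padic_ge q k (x * (spec r G)`_i).
Proof.
elim/poly_ind: G => [|G p [N IH]].
  exists 0%N => k x r _ i; rewrite rmorph0 coef0 mulr0.
  exact: padic_ge0.
have [M HM] := padic_ge_horner_rat p.
exists (N + M)%N => k x r xk i.
rewrite rmorphD rmorphM /= specC specX coefD coefMX coefC mulrDr.
case: i => [|i] /=.
  by rewrite mulr0 add0r; apply: HM; apply: padic_ge_le xk; rewrite leq_add2r leq_addl.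
by rewrite mulr0 addr0; apply: IH; apply: padic_ge_le xk; rewrite leq_add2r leq_addr.
Qed.

Lemma spec_horner_bound (G : {poly {poly rat}}) : exists N, forall k x r (b : int),
  padic_ge q (N + k) x -> padic_ge q k (x * (spec r G).[b%:~R]).
Proof.
have [N HN] := spec_coef_bound G; exists N => k x r b xk.
rewrite horner_coef mulr_sumr; elim/big_ind: _ => [|y z|i _].
- exact: padic_ge0.
- exact: padic_geD.
rewrite mulrA; apply: padic_geMr => //; first exact: HN.
by apply: padic_geX => //; apply: padic_ge_int0.
Qed.

Lemma padic_clear_denominators (S : {poly rat}) : (forall i, padic_ge q 0 S`_i) ->
  exists (c : int) (S0 : {poly int}), ~~ (q %| c)%Z /\ c%:~R *: S = S0^Q.
Proof.
elim/poly_ind: S => [|S s IH] H.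
  exists 1, 0; rewrite rmorph0 scaler0; split=> //.
  by rewrite dvdz1 absz_nat; case: q q_pr => [|[]].
have [i|c [S0 [qc E]]] := IH.
  by have := H i.+1; rewrite coefD coefMX coefC /= addr0.
have [c' [a [qc']]] := H 0%N.
rewrite coefD coefMX coefC /= add0r expr0 mul1r => E'.
exists (c' * c), (c'%:P * S0 * 'X + (c * a)%:P); split.
  by rewrite Euclid_dvdzM // negb_or qc'.
rewrite rmorphD !rmorphM /= !map_polyC map_polyX /= -E mul_polyC scalerA -intrM.
rewrite scalerDr scalerAl; congr (_ + _).
by rewrite -mul_polyC -!polyCM intrM -E'; congr _%:P; ring.
Qed.

(** A multiplier prime to [q] makes [S] integral without changing valuations at [q], and the
    integral criterion applies. *)
Lemma eisenstein_padic (S : {poly rat}) : S \is monic -> (1 < size S)%N ->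
  (forall i, (i < (size S).-1)%N -> padic_ge q 1 S`_i) -> ~ padic_ge q 2 S`_0 ->
  irreducible_poly S.
Proof.
move=> S_mon sS S1 S2.
have S0 i : padic_ge q 0 S`_i.
  case: (ltngtP i (size S).-1) => [/S1||->].
  - exact: padic_ge_le.
  - rewrite -ltnS prednK; last exact: ltn_trans sS.
    by move=> ?; rewrite nth_default //; apply: padic_ge0.
  by rewrite -lead_coefE (monicP S_mon); apply: (padic_ge_int0 q_pr 1).
have [c [S' [qc E]]] := padic_clear_denominators S0.
have c0 : c%:~R != 0 :> rat.
  by rewrite intr_eq0; apply: contraNneq qc => ->; rewrite dvdz0.
have Ei i : c%:~R * S`_i = (S'`_i)%:~R by rewrite -coefZ E coef_map.
have sS' : size S' = size S.
  have := congr1 (fun p : {poly rat} => size p) E.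
  by rewrite /= size_scale // size_map_inj_poly ?rmorph0 //; exact: intr_inj.
have lS' : lead_coef S' = c.
  apply: (@intr_inj rat); rewrite lead_coefE sS' -Ei -lead_coefE (monicP S_mon).
  by rewrite mulr1.
have : irreducible_poly S'.
  apply: (eisenstein_crit q_pr).
  - by rewrite sS' neq_ltn sS orbT.
  - by rewrite lS'.
  - apply/negP => q2; apply: S2.
    have [/(padic_ge_intP q_pr)|] := padic_ge_unit q_pr (padic_ge_int0 q_pr c).
      by rewrite expr1 (negPf qc).
    apply; rewrite mulrC Ei; apply: (padic_ge_int q_pr).
    by move: q2; rewrite !dvdzE abszX !absz_nat.
  move=> i; rewrite sS' => /S1 Si; rewrite -[q%:Z]expr1.
  by apply: (padic_ge_intP q_pr); rewrite -Ei; apply: padic_geMl (padic_ge_int0 _ _) _.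
move/irreducible_rat_int; rewrite -E => -[_ irr]; split=> // p sp pS.
have : p %= c%:~R *: S by apply: irr => //; rewrite dvdpZr.
by move/eqp_trans; apply; apply: eqp_scale.
Qed.

End Denominators.

(** * Transfer from a number field to the rationals *)

(* Relative to the q-adic root b of g with error q^k, every approximate root of
   g in the rationals approximates some e * b with e in T. *)
Definition attracts_roots (q : nat) (g : {poly int}) (T : seq int) :=
  forall k, (2 <= k)%N -> exists b : int, (q%:Z ^+ k %| g.[b])%Z /\
    forall j t, (2 <= j <= k)%N -> padic_ge q j g^Q.[t] ->
      padic_ge q j (\prod_(e <- T) (t - (e * b)%:~R)).

Lemma irreducible_ncoprime_dvd (F : fieldType) (p q : {poly F}) :
  irreducible_poly p -> ~~ coprimep p q -> p %| q.
Proof.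
case=> _ irr ncop; have := irr _ ncop (dvdp_gcdl _ _) => /andP[_ dvd].
exact: dvdp_trans dvd (dvdp_gcdr _ _).
Qed.

Lemma irreducible_dvd_prod (F : fieldType) (p : {poly F}) (I : eqType) (s : seq I)
    (h : I -> {poly F}) :
  irreducible_poly p -> p %| \prod_(i <- s) h i -> exists2 i, i \in s & p %| h i.
Proof.
move=> irr; elim: s => [|i s IH]; first by rewrite big_nil dvdp1 gtn_eqF // irr.1.
rewrite big_cons => dvd; have [cop|ncop] := boolP (coprimep p (h i)).
  have [|j js pj] := IH; first by rewrite -(Gauss_dvdpr _ cop).
  by exists j; rewrite // in_cons js orbT.
by exists i; [exact: mem_head|exact: irreducible_ncoprime_dvd].
Qed.

(** * Lifting from E = Q(theta) = Q[y]/(P) to Q[y] *)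

Section Lift.
Variables (E : fieldType) (rho : {rmorphism rat -> E}) (theta : E) (P : {poly int}).
Hypothesis theta_gen : forall x, exists p, x = (map_poly rho p).[theta].
Hypothesis theta_min : forall p, (map_poly rho p).[theta] = 0 <-> P^Q %| p.

Let ev : {poly rat} -> E := horner_eval theta \o map_poly rho.
HB.instance Definition _ := GRing.RMorphism.copy ev (horner_eval theta \o map_poly rho).

Let evl : {poly {poly rat}} -> {poly E} := map_poly ev.
HB.instance Definition _ := GRing.RMorphism.copy evl (map_poly ev).
Let gl (g : {poly int}) : {poly {poly rat}} := map_poly polyC g^Q.

Lemma evl_int g : evl (gl g) = map_poly intr g.
Proof.
rewrite /evl /gl -!map_poly_comp; apply: eq_map_poly => x /=.
by rewrite /ev /= map_polyC /horner_eval /= hornerC rmorph_int.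
Qed.

Lemma lift_poly (F : {poly E}) : exists G : {poly {poly rat}},
  [/\ evl G = F, size G = size F & F \is monic -> G \is monic].
Proof.
(* The coefficient 1 is lifted to 1, so that monic polynomials have monic lifts. *)
have /boolp.choice[s Hs] : forall x, exists p, ev p = x /\ (x = 1 -> p = 1).
  move=> x; have [->|x1] := eqVneq x 1; first by exists 1; rewrite rmorph1.
  by have [p Dp] := theta_gen x; exists p; split=> // /eqP; rewrite (negPf x1).
have nz x : x != 0 -> s x != 0.
  by apply: contra_neq => s0; have [<- _] := Hs x; rewrite s0 rmorph0.
pose G := \poly_(i < size F) s F`_i.
have sG : size G = size F.
  have [F0|F0] := eqVneq F 0; first by rewrite /G F0 size_poly0 poly_def big_ord0 size_poly0.
  by rewrite size_poly_eq // nz // -lead_coefE lead_coef_eq0.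
exists G; split=> //.
  apply/polyP => i; rewrite coef_map coef_poly; case: ltnP => [_|/leq_sizeP ->] //.
    by case: (Hs F`_i).
    exact: (rmorph0 ev).
move=> /monicP Fm; rewrite monicE lead_coefE sG coef_poly -lead_coefE Fm.
rewrite ltn_predL size_poly_gt0 -lead_coef_eq0 Fm oner_eq0.
by apply/eqP; case: (Hs 1) => _; apply.
Qed.

(** An identity over E thus lifts to one modulo P. Specialized at an integer where P is divisible by
    a high power of [q], it becomes a q-adic congruence, up to the denominators of [R]. *)
Lemma evl_eq0 G : evl G = 0 -> exists R, G = (P^Q)%:P * R.
Proof.
move=> G0; exists (map_poly (fun p => p %/ P^Q) G).
apply/polyP => i; rewrite coefCM coef_map_id0 ?div0p // mulrC divpK //.
apply/theta_min; have := congr1 (fun p : {poly E} => p`_i) G0.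
by rewrite coef_map coef0.
Qed.

Section Eisenstein.
Variables (q : nat) (r : int).
Hypotheses (q_pr : prime q) (Pr : simple_root_mod q P r).

Lemma spec_lift_int s (g : {poly int}) : spec s (gl g) = g^Q.
Proof. exact: spec_map_polyC. Qed.

(** A factorization of g over E lifts to monic [A] and [B], whose specializations at an approximate
    root of P have a product [S] congruent to g modulo [q] squared. Then [S] is still Eisenstein,
    hence irreducible over the rationals; as specialization keeps the degrees of monic polynomials,
    the original factorization is trivial. *)
Lemma irreducible_map_eisenstein (g : {poly int}) : g \is monic -> (1 < size g)%N ->
  (forall i, (i < (size g).-1)%N -> (q %| g`_i)%Z) -> ~~ (q%:Z ^+ 2 %| g`_0)%Z ->
  irreducible_poly (map_poly intr g : {poly E}).
Proof.
move=> g_mon sg g_q g_q2; set gE := map_poly _ _.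
have gE_mon : gE \is monic by rewrite monic_map.
have sgE : size gE = size g by rewrite size_map_poly_id0 // (monicP g_mon) rmorph1 oner_eq0.
split=> [|f f1 /dvdpP[h gE_hf]]; first by rewrite sgE.
have nz : h * f != 0 by rewrite -gE_hf monic_neq0.
have [h0 f0] : h != 0 /\ f != 0 by move: nz; rewrite mulf_eq0 negb_or => /andP.
have lhf : lead_coef h * lead_coef f = 1 by rewrite -lead_coefM -gE_hf (monicP gE_mon).
have lf0 : lead_coef f != 0 by rewrite lead_coef_eq0.
have lh0 : lead_coef h != 0 by rewrite lead_coef_eq0.
have monZ (p : {poly E}) : p != 0 -> (lead_coef p)^-1 *: p \is monic.
  by move=> p0; rewrite monicE lead_coefZ mulVf // lead_coef_eq0.
have [A [evA sA Am]] := lift_poly ((lead_coef h)^-1 *: h).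
have [B [evB sB Bm]] := lift_poly ((lead_coef f)^-1 *: f).
move/(_ (monZ _ h0)): Am; move/(_ (monZ _ f0)): Bm => B_mon A_mon.
rewrite !size_scale ?invr_eq0 // in sA sB.
have [R DR] : exists R, A * B - gl g = (P^Q)%:P * R.
  apply: evl_eq0; rewrite rmorphB rmorphM /= evA evB evl_int -/gE gE_hf.
  by rewrite -scalerAl -scalerAr scalerA -invfM lhf invr1 scale1r subrr.
have [N HN] := spec_coef_bound q_pr R.
(* The denominators of [R] cost [N]; the remaining 2 controls the constant coefficient modulo [q]
   squared. *)
have [s [_ qs]] := hensel q_pr Pr (N + 2).
have key i : padic_ge q 2 ((spec s A * spec s B)`_i - g^Q`_i).
  have := congr1 (fun p => (spec s p)`_i) DR.
  rewrite /= rmorphB !rmorphM /= spec_lift_int coefB => ->.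
  rewrite specC coefCM; apply: HN; rewrite -[s%:~R]/(intr s) horner_map /=.
  exact: padic_ge_int.
have sp_mon (G : {poly {poly rat}}) : G \is monic -> spec s G \is monic.
  by move=> Gm; rewrite /spec monic_map.
have sp_size (G : {poly {poly rat}}) : G \is monic -> size (spec s G) = size G.
  move=> Gm; rewrite /spec size_map_poly_id0 // (monicP Gm) rmorph1 oner_eq0 //.
have sgQ i : g^Q`_i = (g`_i)%:~R by rewrite coef_map.
set S := spec s A * spec s B in key.
have S_mon : S \is monic by rewrite monicMr ?sp_mon.
have sS : size S = size g.
  rewrite -sgE gE_hf !size_mul ?(monic_neq0 (sp_mon _ _)) // -?sA -?sB.
  by rewrite !sp_size.
have : irreducible_poly S.
  apply: (eisenstein_padic q_pr) => //.
  - by rewrite sS.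
  - move=> i; rewrite sS => /g_q gi; rewrite -[S`_i](subrK g^Q`_i).
    apply: padic_geD => //; first by apply: padic_ge_le (key i).
    by rewrite sgQ; apply: padic_ge_int; rewrite ?expr1.
  - move=> S2; case/negP: g_q2; apply: (padic_ge_intP q_pr); rewrite -sgQ.
    by have := padic_geB q_pr S2 (key 0%N); rewrite opprB addrC subrK.
case=> _ /(_ (spec s B)); rewrite sp_size // sB => /(_ f1).
rewrite dvdp_mulIr => /(_ isT) /eqp_size; rewrite sp_size // sB => sf.
by rewrite -dvdp_size_eqp gE_hf ?dvdp_mulIr // -gE_hf sgE -sS sf.
Qed.

(** Otherwise Bezout gives V g + U W = 1, where W is the product of the F - e X. Specialize at a
    q-adic approximate root of P and evaluate at an approximate root [b] of g. Since g(F) = H g, the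
    value [t] of F is an approximate root of g too, so W(b), the product of the t - e b, is
    divisible by a high power of [q]. Then so is 1. *)
Lemma dvdp_comp_attracts_roots (g : {poly int}) (T : seq int) (F : {poly E}) :
  irreducible_poly (map_poly intr g : {poly E}) -> attracts_roots q g T ->
  map_poly intr g %| map_poly intr g \Po F ->
  exists2 e, e \in T & map_poly intr g %| F - e%:~R *: 'X.
Proof.
set gE := map_poly _ _ => gE_irr gT /dvdpP[H DH].
apply: irreducible_dvd_prod => //; set W := \prod_(e <- T) _.
have [//|ndvd] := boolP (gE %| W); exfalso.
have : coprimep gE W by apply: contraNT ndvd; apply: irreducible_ncoprime_dvd.
move=> /Bezout_eq1_coprimepP[[V U] /= EUV].
have [Fl [evF _ _]] := lift_poly F; have [Hl [evH _ _]] := lift_poly H.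
have [Vl [evV _ _]] := lift_poly V; have [Ul [evU _ _]] := lift_poly U.
pose Wl : {poly {poly rat}} := \prod_(e <- T) (Fl - e%:~R *: 'X).
have evW : evl Wl = W.
  rewrite rmorph_prod; apply: eq_bigr => e _.
  rewrite rmorphB /= evF -!mul_polyC rmorphM /= [evl _]map_polyC [evl 'X]map_polyX.
  by rewrite /= rmorph_int.
have [R1 DR1] : exists R, gl g \Po Fl - Hl * gl g = (P^Q)%:P * R.
  apply: evl_eq0; rewrite rmorphB rmorphM /= [evl (_ \Po _)]map_comp_poly -!/(evl _).
  by rewrite evl_int evF evH -/gE DH subrr.
have [R2 DR2] : exists R, Vl * gl g + Ul * Wl - 1 = (P^Q)%:P * R.
  apply: evl_eq0; rewrite rmorphB rmorphD !rmorphM /=.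
  by rewrite evl_int evV evU evW -/gE EUV rmorph1 subrr.
have [NH HH] := spec_horner_bound q_pr Hl; have [N1 H1] := spec_horner_bound q_pr R1.
have [NV HV] := spec_horner_bound q_pr Vl; have [NU HU] := spec_horner_bound q_pr Ul.
have [N2 H2] := spec_horner_bound q_pr R2.
(* [j] pays for the denominators of U and is at least 2, as [attracts_roots] demands; [k] pays for
   all the other denominators and still leaves precision [j]. *)
pose j := (NU + 2)%N; pose k := (NH + N1 + NV + N2 + j)%N.
have [s [_ qs]] := hensel q_pr Pr k.
have [|b [gb nearb]] := gT k; first by rewrite /k /j; lia.
have Ps : padic_ge q k P^Q.[s%:~R].
  by rewrite -[s%:~R]/(intr s) horner_map; apply: padic_ge_int.
have gbk : padic_ge q k g^Q.[b%:~R].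
  by rewrite -[b%:~R]/(intr b) horner_map; apply: padic_ge_int.
pose t := (spec s Fl).[b%:~R].
have gt : padic_ge q j g^Q.[t].
  have := congr1 (fun p => (spec s p).[b%:~R]) DR1.
  rewrite /= rmorphB !rmorphM /= {1}/spec map_comp_poly -!/(spec _ _) spec_lift_int.
  rewrite specC !hornerE horner_comp -/t => /(canRL (subrK _)) ->.
  apply: padic_geD => //; first by apply: H1; apply: padic_ge_le Ps; rewrite /k; lia.
  by rewrite mulrC; apply: HH; apply: padic_ge_le gbk; rewrite /k; lia.
have Wt : padic_ge q j (spec s Wl).[b%:~R].
  rewrite /Wl rmorph_prod horner_prod.
  rewrite (eq_bigr (fun e : int => t - (e * b)%:~R)); last first.
    move=> e _; rewrite rmorphB /= -mul_polyC rmorphM /= specC specX.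
    by rewrite -[e%:~R](rmorph_int polyC) !hornerE intrM.
  by apply: nearb => //; rewrite /k /j; lia.
have : padic_ge q 1 (1%:Z)%:~R.
  have := congr1 (fun p => (spec s p).[b%:~R]) DR2.
  rewrite /= rmorphB rmorphD !rmorphM rmorph1 /= spec_lift_int specC !hornerE.
  move/(canRL (subrK _))/(canLR (addKr _)) => <-.
  apply: padic_geD => //; last apply: padic_geD => //.
  - by apply: padic_geN => //; apply: H2; apply: padic_ge_le Ps; rewrite /k /j; lia.
  - by rewrite mulrC; apply: HV; apply: padic_ge_le gbk; rewrite /k /j; lia.
  - by rewrite mulrC; apply: HU; apply: padic_ge_le Wt; rewrite /j; lia.
move/(padic_ge_intP q_pr); rewrite expr1 dvdz1 absz_nat => /eqP q1.
by move: q_pr; rewrite q1.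
Qed.

End Eisenstein.
End Lift.

(** * The trinomials *)

Lemma simple_root_mod_near (q : nat) (g : {poly int}) (r : int) k : prime q ->
  simple_root_mod q g r -> exists b : int,
    [/\ (q %| b - r)%Z, (q%:Z ^+ k %| g.[b])%Z & ~~ (q %| g^`().[b])%Z].
Proof.
move=> q_pr gr; have [b [br gb]] := hensel q_pr gr k; exists b; split=> //.
have [u Du] := horner_sub g^`() b r.
have [_] := gr; apply: contra => q'b.
rewrite (_ : g^`().[r] = g^`().[b] - (b - r) * u); last by rewrite -Du; ring.
by apply: rpredB => //; rewrite dvdz_mulr.
Qed.

Section Trinomial.
Variables (q l n m : nat) (c : int).
Hypotheses (q_pr : prime q) (l_pr : prime l) (neq_ql : q != l).
Hypotheses (m_gt1 : (1 < m)%N) (lt_mn : (m < n)%N) (lc : (l %| c)%Z).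

(** Used with m = n - 1, c = l and with n = 4, m = 2, c = l^2. *)
Definition trinomial : {poly int} := 'X^n - c *: 'X^m + (q%:Z * l%:Z)%:P.

Lemma trinomialE : trinomial = 'X^n + (- (c *: 'X^m) + (q%:Z * l%:Z)%:P).
Proof. by rewrite addrA. Qed.

Lemma size_trinomial_tail : (size (- (c *: 'X^m) + (q%:Z * l%:Z)%:P : {poly int})%R < n.+1)%N.
Proof.
apply: leq_ltn_trans (size_polyD _ _) _; rewrite gtn_max size_polyN.
rewrite (leq_ltn_trans (size_scale_leq _ _)) ?size_polyXn //=.
by apply: leq_ltn_trans (size_polyC_leq1 _) _; rewrite ltnS (leq_trans _ lt_mn).
Qed.

Lemma size_trinomial : size trinomial = n.+1.
Proof. by rewrite trinomialE size_polyDl ?size_polyXn ?size_trinomial_tail. Qed.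

Lemma trinomial_monic : trinomial \is monic.
Proof.
by rewrite monicE trinomialE lead_coefDl ?lead_coefXn // size_polyXn size_trinomial_tail.
Qed.

Lemma coef_trinomial i : (i < n)%N -> trinomial`_i =
  - (c * (i == m)%:R) + (if i == 0%N then q%:Z * l%:Z else 0).
Proof.
by move=> lt_in; rewrite !coefD coefN coefZ coefC !coefXn (ltn_eqF lt_in) add0r.
Qed.

Let coprime_ql : ~~ (q %| l%:Z)%Z.
Proof. by rewrite dvdzE !absz_nat dvdn_prime2. Qed.

Lemma trinomial_eisenstein i : (i < n)%N -> (l %| trinomial`_i)%Z.
Proof.
move=> /coef_trinomial ->; rewrite rpredD ?rpredN ?dvdz_mulr //.
by case: eqP => _; rewrite ?dvdz0 // dvdz_mull.
Qed.

Lemma trinomial_eisenstein0 : ~~ (l%:Z ^+ 2 %| trinomial`_0)%Z.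
Proof.
rewrite coef_trinomial ?(leq_trans _ lt_mn) // (ltn_eqF (ltnW m_gt1)) mulr0 oppr0 add0r.
rewrite exprS expr1 dvdz_mul2r; last by rewrite eqz_nat -lt0n prime_gt0.
by rewrite dvdzE !absz_nat dvdn_prime2 // eq_sym.
Qed.

Lemma horner_trinomial x : trinomial.[x] = x ^+ n - c * x ^+ m + q%:Z * l%:Z.
Proof. by rewrite /trinomial !hornerE. Qed.

Lemma horner_trinomialQ t :
  trinomial^Q.[t] = t ^+ n - c%:~R * t ^+ m + (q%:Z * l%:Z)%:~R.
Proof.
by rewrite /trinomial rmorphD rmorphB /= map_polyZ !map_polyXn map_polyC !hornerE.
Qed.

(** If [q] divided [t], then t^m would be divisible by [q] squared since m is at least 2, and hence
    so would q l. So [t] is a unit, and t^m can be cancelled from t^m (t^(n-m) - c), which is 0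
    modulo [q]. *)
Lemma trinomial_approx_root j t : (2 <= j)%N -> padic_ge q j trinomial^Q.[t] ->
  padic_ge q 0 t /\ padic_ge q 1 (t ^+ (n - m) - c%:~R).
Proof.
move=> j2 gt; have t0 : padic_ge q 0 t.
  apply: (padic_ge0_monic q_pr trinomial_monic); last exact: padic_ge_le gt.
  by rewrite size_trinomial ltnS (leq_trans _ lt_mn).
have Dn : t ^+ n = t ^+ (n - m) * t ^+ m by rewrite -exprD subnK // ltnW.
split=> //; have [t1|u] := padic_ge_unit q_pr t0.
  have tm : padic_ge q 2 (t ^+ m).
    have -> : m = (2 + (m - 2))%N by rewrite subnKC.
    rewrite exprD; apply: padic_geMr => //; last exact: padic_geX.
    by rewrite expr2; apply: (padic_geM q_pr t1 t1).
  have : padic_ge q 2 (q%:Z * l%:Z)%:~R.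
    have -> : (q%:Z * l%:Z)%:~R = trinomial^Q.[t] - (t ^+ (n - m) - c%:~R) * t ^+ m :> rat.
      by rewrite horner_trinomialQ Dn; ring.
    apply: padic_geB => //; first exact: padic_ge_le gt.
    apply: padic_geMl => //; apply: padic_geB => //; first exact: padic_geX.
    exact: padic_ge_int0.
  move/(padic_ge_intP q_pr); rewrite expr2 dvdz_mul2l ?(negPf coprime_ql) //.
  by rewrite eqz_nat -lt0n prime_gt0.
have : padic_ge q 1 ((t ^+ (n - m) - c%:~R) * t ^+ m).
  have -> : (t ^+ (n - m) - c%:~R) * t ^+ m = trinomial^Q.[t] - (q%:Z * l%:Z)%:~R.
    by rewrite horner_trinomialQ Dn; ring.
  apply: padic_geB => //; first by apply: padic_ge_le gt; apply: ltnW.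
  by apply: padic_ge_int => //; rewrite expr1 dvdz_mulr.
move: m (t ^+ (n - m) - c%:~R) => k A; elim: k => [|i IH]; first by rewrite mulr1.
by rewrite exprSr mulrA => /u.
Qed.

End Trinomial.

Lemma trinomial_deriv q l n m c (b : int) :
  (trinomial q l n m c)^`().[b] = b ^+ n.-1 *+ n - c * (b ^+ m.-1 *+ m).
Proof.
by rewrite /trinomial derivD derivB derivZ !derivXn derivC !(hornerE, hornerMn).
Qed.

Section Concrete.
Variables (q l : nat).
Hypotheses (q_pr : prime q) (l_pr : prime l) (neq_ql : q != l).

Let coprime_ql k : ~~ (q %| l%:Z ^+ k)%Z.
Proof.
apply/negP => /(Euclid_dvdzX q_pr).
by rewrite dvdzE !absz_nat dvdn_prime2 // (negPf neq_ql).
Qed.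

(** Modulo [q] the point [l] is a root with derivative l^(n-1), a unit. As n - m = 1, every
    approximate root is congruent to [l], hence close to its Hensel lift. *)
Lemma trinomial_attracts1 n : (2 < n)%N ->
  attracts_roots q (trinomial q l n n.-1 l) [:: 1].
Proof.
case: n => // n n2 k k2; set g := trinomial _ _ _ _ _.
have gl : simple_root_mod q g l.
  split; first by rewrite horner_trinomial /= exprS subrr add0r dvdz_mulr.
  rewrite trinomial_deriv /= mulrnAr -exprS prednK; last exact: ltnW.
  by rewrite mulrS addrK.
have [b [bl gb g'b]] := simple_root_mod_near k q_pr gl.
exists b; split=> // j t /andP[j2 jk] gt.
rewrite big_seq1 mul1r; apply: (padic_ge_near q_pr g'b gb) => //.
have [_] := trinomial_approx_root q_pr l_pr neq_ql n2 (leqnn n.+1) j2 gt.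
rewrite subSnn expr1 => tl; have -> : t - b%:~R = (t - l%:~R) - (b - l%:Z)%:~R.
  by rewrite intrB; ring.
by apply: padic_geB => //; apply: padic_ge_int; rewrite ?expr1.
Qed.

(** Here t^2 is l^2 modulo [q], so [t] is congruent to l or -l, and evenness of g reduces the second
    case to the first. The derivative at [l] is 2 l^3, a unit because [q] is odd. *)
Lemma trinomial_attracts2 : (2 < q)%N ->
  attracts_roots q (trinomial q l 4 2 (l%:Z ^+ 2)) [:: 1; -1].
Proof.
move=> q2 k k2; set g := trinomial _ _ _ _ _.
have gl : simple_root_mod q g l.
  split; first by rewrite horner_trinomial /= -exprD subrr add0r dvdz_mulr.
  rewrite trinomial_deriv /= expr1.
  have -> : l%:Z ^+ 3 *+ 4 - l%:Z ^+ 2 * (l%:Z *+ 2) = 2%:Z * l%:Z ^+ 3 by ring.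
  rewrite Euclid_dvdzM // negb_or coprime_ql andbT.
  by rewrite dvdzE !absz_nat dvdn_prime2 // neq_ltn q2 orbT.
have [b [bl gb g'b]] := simple_root_mod_near k q_pr gl.
exists b; split=> // j t /andP[j2 jk] gt.
rewrite big_cons big_seq1 mul1r mulN1r.
have [t0] := trinomial_approx_root q_pr l_pr neq_ql (isT : 1 < 2)%N (isT : 2 < 4)%N j2 gt.
rewrite (_ : 4 - 2 = 2)%N // => t2.
have near x : padic_ge q 1 (x - l%:~R) -> padic_ge q j g^Q.[x] -> padic_ge q j (x - b%:~R).
  move=> xl gx; apply: (padic_ge_near q_pr g'b gb) => //.
  have -> : x - b%:~R = (x - l%:~R) - (b - l%:Z)%:~R by rewrite intrB; ring.
  by apply: padic_geB => //; apply: padic_ge_int; rewrite ?expr1.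
have int0 := padic_ge_int0 q_pr.
have [tl|tl] : padic_ge q 1 (t - l%:~R) \/ padic_ge q 1 (t + l%:~R).
  apply: padic_ge_prime => //; first by apply: padic_geD.
  by rewrite (_ : _ * _ = t ^+ 2 - (l%:Z ^+ 2)%:~R) // rmorphXn /=; ring.
  apply: padic_geMr => //; first exact: near.
  by apply: padic_geB.
apply: padic_geMl => //; first by apply: padic_geB.
rewrite (_ : _ - _ = - (- t - b%:~R)); last by rewrite intrN; ring.
apply: padic_geN => //; apply: near.
  by rewrite -opprD; apply: padic_geN.
by move: gt; rewrite /g !horner_trinomialQ !(exprM _ 2 2) sqrrN.
Qed.

End Concrete.

(** * Rigid polynomials over a number field *)

Section NumberField.
Variables (E : fieldType) (rho : {rmorphism rat -> E}) (theta : E) (P : {poly int}).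
Hypothesis theta_gen : forall x, exists p, x = (map_poly rho p).[theta].
Hypothesis theta_min : forall p, (map_poly rho p).[theta] = 0 <-> P^Q %| p.
Hypotheses (sP : (1 < size P)%N) (sepP : coprimep P^Q P^Q^`()).

(* The conjugates in E(z) of a root z of g are the e * z with e in T. *)
Definition rigid (g : {poly int}) (T : seq int) := 
  [/\ g \is monic, irreducible_poly (map_poly intr g : {poly E}) &
   forall F : {poly E}, map_poly intr g %| map_poly intr g \Po F ->
     exists2 e, e \in T & map_poly intr g %| F - e%:~R *: 'X].

Lemma exists_two_primes : exists (q l : nat) (r s : int),
  [/\ prime q /\ prime l, (2 < q)%N, q != l, simple_root_mod q P r & simple_root_mod l P s].
Proof.
have [q [r [q_pr q2 Pr]]] := exists_simple_root_mod 2 sP sepP.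
have [l [s [l_pr lq Ps]]] := exists_simple_root_mod q sP sepP.
by exists q, l, r, s; split=> //; rewrite neq_ltn lq.
Qed.

Lemma exists_rigid1 n : (2 < n)%N -> exists g : {poly int}, size g = n.+1 /\ rigid g [:: 1].
Proof.
move=> n2; have [q [l [r [s [[q_pr l_pr] q2 neq_ql Pr Ps]]]]] := exists_two_primes.
have n1 : (1 < n.-1)%N by case: n n2.
have n_lt : (n.-1 < n)%N by case: n n2 {n1}.
have sg := size_trinomial q l l n_lt; have gm := trinomial_monic q l l n_lt.
exists (trinomial q l n n.-1 l); split=> //.
have irr : irreducible_poly (map_poly intr (trinomial q l n n.-1 l) : {poly E}).
  apply: (irreducible_map_eisenstein theta_gen theta_min l_pr Ps) => //.
  - by rewrite sg ltnS (leq_trans _ n2).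
  - by rewrite sg => i; apply: trinomial_eisenstein.
  - exact: trinomial_eisenstein0.
split=> // F; apply: (dvdp_comp_attracts_roots theta_gen theta_min q_pr Pr) => //.
exact: trinomial_attracts1.
Qed.

Lemma exists_rigid2 : exists g : {poly int},
  [/\ size g = 5, g \Po (- 'X) = g & rigid g [:: 1; -1]].
Proof.
have [q [l [r [s [[q_pr l_pr] q2 neq_ql Pr Ps]]]]] := exists_two_primes.
have sg := size_trinomial q l (l%:Z ^+ 2) (isT : 2 < 4)%N.
have gm := trinomial_monic q l (l%:Z ^+ 2) (isT : 2 < 4)%N.
exists (trinomial q l 4 2 (l%:Z ^+ 2)); split=> //.
  rewrite /trinomial !rmorphD rmorphN /= comp_polyZ !comp_Xn_poly comp_polyC.
  by rewrite !(exprM _ 2 2) sqrrN.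
have irr : irreducible_poly (map_poly intr (trinomial q l 4 2 (l%:Z ^+ 2)) : {poly E}).
  apply: (irreducible_map_eisenstein theta_gen theta_min l_pr Ps) => //.
  - by rewrite sg.
  - by rewrite sg => i; apply: trinomial_eisenstein => //; rewrite dvdz_exp.
  - exact: trinomial_eisenstein0.
split=> // F; apply: (dvdp_comp_attracts_roots theta_gen theta_min q_pr Pr) => //.
exact: trinomial_attracts2.
Qed.

End NumberField.

(** * Cyclotomic extensions *)

(** Cauchy's theorem gives a subgroup of prime order p dividing [m]; a subgroup of order m/p of the
    quotient, found by induction, is pulled back. *)
Lemma abelian_exists_subgroup m : forall (gT : finGroupType) (G : {group gT}),
  abelian G -> (m %| #|G|)%N -> exists H : {group gT}, H \subset G /\ #|H| = m.
Proof.
elim/ltn_ind: m => m IH gT G abG mG.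
have m_gt0 : (0 < m)%N by apply: dvdn_gt0 mG.
case: (ltnP 1 m) => [m_gt1|m_le1]; last first.
  exists 1%G; rewrite sub1G cards1; split=> //; apply/esym/eqP.
  by rewrite eqn_leq m_le1.
have p_pr := pdiv_prime m_gt1; have p_m := pdiv_dvd m.
have [x Gx ox] := Cauchy p_pr (dvdn_trans p_m mG).
have nxG : (<[x]>%G <| G)%g by rewrite -sub_abelian_normal ?cycle_subG.
have cardGx : (#|(G / <[x]>)%g| * pdiv m)%N = #|G|.
  by rewrite card_quotient ?normal_norm // mulnC -ox orderE Lagrange ?cycle_subG.
have Dm := divnK p_m.
have [|||K [sK oK]] := IH (m %/ pdiv m)%N _ _ [group of (G / <[x]>)%g].
- by rewrite ltn_Pdiv // prime_gt1.
- exact: quotient_abelian.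
- by rewrite -(@dvdn_pmul2r (pdiv m)) ?prime_gt0 // Dm cardGx.
have [H DK sxH sHG] := inv_quotientS nxG sK.
exists H; split=> //; have nxH : (<[x]>%G <| H)%g.
  by apply: normalS nxG.
rewrite -(Lagrange sxH) -card_quotient ?normal_norm // -DK oK /=.
by rewrite -orderE ox mulnC.
Qed.

(** A prime power p^k exactly dividing [a] contributes (p - 1) p^(2k-1) to the totient of the
    square, and 2k - 1 is at least k. *)
Lemma dvdn_totient_sqr a : (0 < a)%N -> (a %| totient (a ^ 2))%N.
Proof.
move=> a0; have a20 : (0 < a ^ 2)%N by rewrite expn_gt0 a0.
rewrite totientE // {1}(prod_prime_decomp a0) prime_decompE big_map /=.
rewrite primesX //; apply: (big_ind2 (fun x y => x %| y)%N) => // [x1 y1 x2 y2|p _].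
  exact: dvdn_mul.
rewrite lognX; have [->|l0] := posnP (logn p a); first by rewrite expn0 dvd1n.
by apply/dvdn_mull/dvdn_exp2l; lia.
Qed.

(** Over the rationals this is the minimal polynomial of a primitive root of unity in [algC]. *)
Lemma Cyclotomic_irreducible n : (0 < n)%N -> irreducible_poly ('Phi_n)^Q.
Proof.
move=> n0; have [z prim_z] := C_prim_root_exists n0.
have [p [Dp p_mon] dvp] := minCpolyP z.
have Dphi : ('Phi_n)^Q = p.
  apply: (map_poly_inj (ratr : rat -> algC)).
  rewrite -Dp (minCpoly_cyclotomic prim_z) -(Cintr_Cyclotomic prim_z).
  by rewrite -map_poly_comp; apply: eq_map_poly => x /=; rewrite ratr_int.
have pz : root (map_poly (ratr : rat -> algC) p) z by rewrite dvp.
rewrite Dphi; split=> [|q q1 /dvdpP[r Dr]].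
  have := root_size_gt1 _ pz; rewrite size_map_poly map_poly_eq0; apply.
  exact: monic_neq0.
have nz : r * q != 0 by rewrite -Dr monic_neq0.
have [r0 q0] : r != 0 /\ q != 0 by move: nz; rewrite mulf_eq0 negb_or => /andP.
have := pz; rewrite Dr rmorphM rootM !dvp => /orP[pr|pq]; last first.
  by rewrite /eqp -Dr pq andbT Dr dvdp_mulIr.
have := dvdp_leq r0 pr; rewrite Dr size_mul //.
have := q1; have := q0; rewrite -size_poly_gt0; have := r0; rewrite -size_poly_gt0.
by move: (size r) (size q) => u v; lia.
Qed.

Lemma pchar_alg (K : fieldType) (R : fieldExtType K) :
  [pchar K] =i pred0 -> [pchar R] =i pred0.
Proof. by move=> K0 p; rewrite pchar_lalg. Qed.

Lemma polyOver1_map (K : fieldType) (L : fieldExtType K) (p : {poly L}) :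
  p \is a polyOver 1%VS -> exists q : {poly K}, p = map_poly (in_alg L) q.
Proof. by move/polyOver1P => [q ->]; exists q. Qed.

(** [theta] is a primitive element and [P] is its minimal polynomial cleared of denominators, so it
    need not be monic. Separability in characteristic 0 gives the coprimality. *)
Lemma number_field_generator (L : fieldExtType rat) : exists (theta : L) (P : {poly int}),
  [/\ forall x, exists p, x = (map_poly (in_alg L) p).[theta],
      forall p, (map_poly (in_alg L) p).[theta] = 0 <-> P^Q %| p,
      (1 < size P)%N & coprimep P^Q P^Q^`()].
Proof.
have ch0 : [pchar L] =i pred0 by apply: pchar_alg; apply: pchar_num.
have sepL : separable 1 {:L} by apply/separableP => y _; apply: pcharf0_separable.
pose theta := separable_generator 1 {:L}.
have genL : {:L}%VS = <<1; theta>>%VS.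
  by apply: eq_adjoin_separable_generator => //; apply: sub1v.
have [p0 Dp0] := polyOver1_map (minPolyOver 1 theta).
have [P [a a0 DP]] := rat_poly_scale p0.
have aQ : (a%:~R^-1 : rat) != 0 by rewrite invr_eq0 intr_eq0.
have p0P : p0 %= P^Q by rewrite DP eqp_scale.
exists theta, P; split.
- move=> x; have : x \in <<1; theta>>%VS by rewrite -genL memvf.
  by case/Fadjoin_polyP => q /polyOver1_map[r ->] ->; exists r.
- move=> p; rewrite -(eqp_dvdl _ p0P) -(dvdp_map (in_alg L)) -Dp0.
  split=> [/eqP pt|]; first by apply: minPoly_dvdp => //; apply: alg_polyOver.
  by case/dvdpP=> u ->; rewrite hornerM minPolyxx mulr0.
- rewrite -(size_map_inj_poly (@intr_inj rat)) ?rmorph0 // -(eqp_size p0P).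
  by rewrite -(size_map_poly (in_alg L)) -Dp0 size_minPoly.
have := pcharf0_separable 1%AS ch0 theta; rewrite /separable_element Dp0 separable_map.
by rewrite (eqp_separable p0P) unlock.
Qed.

Lemma closed_prim_root_exists (F : closedFieldType) n : (0 < n)%N ->
  [pchar F] =i pred0 -> exists z : F, n.-primitive_root z.
Proof.
move=> n0 ch0; have [rs Drs] := closed_field_poly_normal ('X^n - 1 : {poly F}).
have mon : ('X^n - 1 : {poly F}) \is monic by apply: monicXnsubC.
rewrite (monicP mon) scale1r in Drs.
have n_neq0 : n%:R != 0 :> F by rewrite ((pcharf0P _).1 ch0) -lt0n.
have := @separable_Xn_sub_1 F n n_neq0; rewrite Drs separable_prod_XsubC => urs.
have := congr1 (fun p : {poly F} => size p) Drs.
rewrite /= size_prod_XsubC size_XnsubC // => -[] Dn.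
have : has n.-primitive_root rs.
  apply: has_prim_root => //; last by rewrite Dn.
  apply/allP => x xrs; rewrite unity_rootE -subr_eq0.
  have : root ('X^n - 1) x by rewrite Drs root_prod_XsubC.
  by rewrite /root !hornerE.
by case/hasP => z _ prim; exists z.
Qed.

Lemma irreducible_factor_root (K L : fieldType) (iota : {rmorphism K -> L})
    (z : L) (p : {poly K}) :
  p != 0 -> root (map_poly iota p) z ->
  exists2 q, irreducible_poly q & root (map_poly iota q) z.
Proof.
have [n] := ubnP (size p); elim: n => // n IH in p * => sp p0 pz.
have p1 : (1 < size p)%N.
  by have := root_size_gt1 _ pz; rewrite size_map_poly map_poly_eq0; apply.
case: (pselect (irreducible_poly p)) => [irr|nirr]; first by exists p.
have [q [q1 /dvdpP[r Dr] nqp]] : exists q : {poly K}, [/\ size q != 1%N, q %| p & ~~ (q %= p)].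
  apply/not_existsP => H; apply: nirr; split=> // q q1 qp.
  by apply/negPn/negP => nqp; apply: (H q).
have nz : r * q != 0 by rewrite -Dr.
have [r0 q0] : r != 0 /\ q != 0 by move: nz; rewrite mulf_eq0 negb_or => /andP.
have qp : q %| p by rewrite Dr dvdp_mulIr.
have lt_qp : (size q < size p)%N.
  by rewrite ltn_neqAle dvdp_leq // andbT (dvdp_size_eqp qp).
have lt_rp : (size r < size p)%N.
  move: q1 q0 r0; rewrite Dr -!size_poly_gt0 => q1 q0 r0.
  rewrite size_mul -?size_poly_gt0 //.
  by move: (size r) (size q) q1 q0 r0 => u v; lia.
move: pz; rewrite Dr rmorphM rootM => /orP[].
  by apply: IH => //; apply: leq_trans lt_rp _.
by apply: IH => //; apply: leq_trans lt_qp _.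
Qed.

Section Cyclotomic.
Variables (K : fieldType) (L : fieldExtType K) (N : nat) (zeta : L).
Hypotheses (prim : N.-primitive_root zeta) (gen : <<1; zeta>>%VS = {:L}%VS).

Lemma cyclotomic_splitting : splitting_field_axiom L.
Proof.
exists ('X^N - 1); first by rewrite rpredB ?rpredX ?polyOverX ?rpred1.
exists [seq zeta ^+ i | i <- index_iota 0 N].
  by rewrite big_map factor_Xn_sub_1 // eqpxx.
apply/eqP; rewrite eqEsubv subvf -gen; apply/FadjoinP; split; first exact: subv_adjoin_seq.
apply/seqv_sub_adjoin/mapP; exists (1 %% N)%N; last by rewrite prim_expr_mod.
by rewrite mem_index_iota ltn_mod (prim_order_gt0 prim).
Qed.
End Cyclotomic.

(** An automorphism is determined by the exponent k to which it raises [zeta], and exponents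
    multiply commutatively. *)
Lemma cyclotomic_abelian (K : fieldType) (L : splittingFieldType K) N (zeta : L) :
  N.-primitive_root zeta -> <<1; zeta>>%VS = {:L}%VS -> abelian 'Gal({:L} / 1).
Proof.
move=> prim gen; apply/centsP => x Gx y Gy; apply/eqP.
have pow (u : gal_of {:L}) : exists k, u zeta = zeta ^+ k.
  have : (u zeta) ^+ N = 1 by rewrite -rmorphXn prim_expr_order // rmorph1.
  by move/(prim_rootP prim) => [k ->]; exists k.
have [k Dk] := pow x; have [l Dl] := pow y.
have Exy : ((x * y)%g : gal_of {:L}) zeta = ((y * x)%g : gal_of {:L}) zeta.
  by rewrite !galM ?memvf // Dk Dl !rmorphXn /= Dk Dl -!exprM mulnC.
apply/gal_eqP => a _; have : a \in <<1; zeta>>%VS by rewrite gen memvf.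
move=> /Fadjoin_polyP[p p1 ->].
have fix_p (u : gal_of {:L}) : map_poly u p = p.
  have [q ->] := polyOver1_map p1; rewrite -map_poly_comp; apply: eq_map_poly => c /=.
  by rewrite linearZ /= rmorph1.
by rewrite -!horner_map !fix_p /= Exy.
Qed.

(** * Galois subextensions of prescribed degree *)

Section GaloisData.
Variables (K : fieldType) (L : splittingFieldType K) (d : nat).
Hypotheses (ch0 : [pchar K] =i pred0) (abG : abelian 'Gal({:L} / 1)).
Hypothesis d_dvd : (d %| \dim {:L})%N.

Let gal1L : galois 1 {:L}.
Proof.
rewrite /galois sub1v normalFieldf andbT /=; apply/separableP => y _.
by apply: pcharf0_separable; apply: pchar_alg.
Qed.

Lemma gal_fixed_scalar (c : L) :
  (forall x : gal_of {:L}, x c = c) -> exists k : K, c = k%:A.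
Proof.
move=> cfix; have : c \in fixedField ('Gal({:L} / 1))%g.
  by apply/fixedFieldP => //; rewrite memvf.
by rewrite (galois_fixedField gal1L) => /vlineP.
Qed.

Lemma gal_transitive (a b : L) : root (minPoly 1 a) b -> exists x : gal_of {:L}, x a = b.
Proof.
move=> ab; have [_ _ nL] := and3P gal1L.
by have [x _ <-] := normalField_root_minPoly (sub1v _) nL (memvf a) ab; exists x.
Qed.

(** [M] is the fixed field of a subgroup of index [d], normal since the group is abelian, and [s]
    lists the conjugates of a generator of [M]. Each of them lies in [M] and has degree [d], so it
    generates [M] as well. *)
Lemma abelian_galois_element : exists (s : seq L) (p : {poly K}),
  [/\ uniq s, size s = d, map_poly (in_alg L) p = \prod_(b <- s) ('X - b%:P),
    {in s &, forall b b', exists q : {poly K}, b' = (map_poly (in_alg L) q).[b]} &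
    {in s &, forall b b', root (minPoly 1 b) b'}].
Proof.
have dG : (d %| #|('Gal({:L} / 1))%g|)%N by rewrite -galois_dim // dimv1 divn1.
have [|H [sHG oH]] := @abelian_exists_subgroup (#|('Gal({:L} / 1))%g| %/ d) _ _ abG.
  by rewrite -{2}(divnK dG) dvdn_mulr.
pose M := [aspace of fixedField H].
have dimM : \dim M = d.
  have := dim_fixed_galois gal1L sHG; rewrite dimv1 divn1 => ->.
  by rewrite -divgS // oH divnA // mulKn // cardG_gt0.
have nsH : (H <| 'Gal({:L} / 1))%g by rewrite -sub_abelian_normal.
have galM : galois 1 M := normal_fixedField_galois gal1L nsH.
have [_ sepM nM] := and3P galM.
pose a := separable_generator 1 M.
have DM : (M = <<1; a>> :> {vspace L})%VS.
  by apply: eq_adjoin_separable_generator; rewrite ?sub1v.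
have aM : a \in M by rewrite [M : {vspace L}]DM memv_adjoin.
have [r [_ ur Da]] := elimT (galois_factors (sub1v M)) galM a aM.
set s := [seq _ | _ <- r] in ur Da; have [p Dp] := polyOver1_map (minPolyOver 1 a).
have dega : adjoin_degree 1 a = d by rewrite adjoin_degreeE dimv1 divn1 -DM.
have sM b : b \in s -> b \in M by case/mapP => x _ ->; apply: memv_gal.
have sroot b : b \in s -> root (minPoly 1 a) b by rewrite Da root_prod_XsubC.
have minb b : b \in s -> minPoly 1 b = minPoly 1 a.
  move=> bs; apply/eqP; rewrite -eqp_monic ?monic_minPoly //.
  have := minPoly_irr (minPolyOver 1 b) (minPoly_dvdp (minPolyOver 1 a) (sroot b bs)).
  rewrite -size_poly_eq1 size_minPoly orbF //.
exists s, p; split=> //.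
- by apply: succn_inj; rewrite -(size_prod_XsubC s id) -Da size_minPoly dega.
- by rewrite -Dp.
- move=> b b' bs b's.
  suff : b' \in <<1; b>>%VS by case/Fadjoin_polyP => q /polyOver1_map[q' ->] ->; exists q'.
  suff -> : (<<1; b>> = M)%VS by apply: sM.
  apply/eqP; rewrite eqEdim sub_adjoin1v; apply/andP; split; first exact: sM.
  rewrite dimM dim_Fadjoin dimv1 muln1 -ltnS -size_minPoly minb // size_minPoly dega //.
by move=> b b' bs b's; rewrite minb // sroot.
Qed.

End GaloisData.

(** The cyclotomic polynomial may be reducible over K, so L is built from an irreducible factor of
    X^N - 1 vanishing at a primitive root of unity [z] of [Kbar]; [j] sends [zeta] to [z]. *)
Lemma cyclotomic_extension (K : fieldType) (Kbar : closedFieldType)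
    (iota : {rmorphism K -> Kbar}) N : [pchar K] =i pred0 -> (0 < N)%N ->
  exists (L : splittingFieldType K) (j : {rmorphism L -> Kbar}) (zeta : L),
    [/\ N.-primitive_root zeta, <<1; zeta>>%VS = {:L}%VS & forall x, j x%:A = iota x].
Proof.
move=> ch0 N0; have ch0' : [pchar Kbar] =i pred0.
  by move=> x; rewrite (fmorph_pchar iota) ch0.
have [z z_prim] := closed_prim_root_exists N0 ch0'.
have Xn0 : 'X^N - 1 != 0 :> {poly K} by rewrite monic_neq0 // monicXnsubC.
have [|p p_irr pz] := @irreducible_factor_root _ _ iota z _ Xn0.
  by rewrite rmorphB rmorph1 /= map_polyXn /root !hornerE prim_expr_order // subrr.
pose E := SubFieldExtType pz p_irr.
pose j : {rmorphism E -> Kbar} := @subfx_inj _ _ iota z p.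
pose zeta : E := @subfx_root _ _ iota z p.
have p0 := irredp_neq0 p_irr.
have prim : N.-primitive_root zeta.
  by rewrite -(fmorph_primitive_root j) /j /= subfx_inj_root.
have gen : <<1; zeta>>%VS = {:E}%VS.
  apply/vspaceP => x; rewrite memvf; apply/Fadjoin_polyP.
  have [q Dq] := subfxEroot pz p0 x; exists (map_poly (in_alg E) q) => //.
  exact: alg_polyOver.
pose E' : splittingFieldType K := HB.pack E
  (FieldExt_isSplittingField.Build K E (cyclotomic_splitting prim gen)).
by exists E', j, zeta; split=> // x; apply: subfx_inj_base.
Qed.

Lemma root_prod_has (R : idomainType) (I : Type) (s : seq I) (h : I -> {poly R}) x :
  root (\prod_(i <- s) h i) x = has (fun i => root (h i) x) s.
Proof.
elim: s => [|i s IH]; first by rewrite big_nil (negPf (root1 x)).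
by rewrite big_cons rootM IH.
Qed.

(** The product is [L : Q] by the tower law, a multiple of [Q(zeta) : Q]. *)
Lemma dvdn_totient_dim (K : fieldExtType rat) (L : fieldExtType K) N (zeta : L) :
  N.-primitive_root zeta -> (totient N %| \dim {:L} * \dim {:K})%N.
Proof.
move=> prim; pose L0 := baseFieldType L; pose z : L0 := zeta.
have N0 := prim_order_gt0 prim.
have -> : (\dim {:L} * \dim {:K})%N = \dim {:L0}.
  rewrite -dim_baseVspace; congr (\dim _); apply/vspaceP => x.
  by rewrite mem_baseVspace; apply/idP/idP => _; apply: memvf.
have Phi_z : root (map_poly (in_alg L0) ('Phi_N)^Q) z.
  have map_Phi n : map_poly (in_alg L0) ('Phi_n)^Q = map_poly intr 'Phi_n.
    rewrite -map_poly_comp; apply: eq_map_poly => x.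
    by rewrite /= -[LHS]/(in_alg L0 _) rmorph_int.
  have : root (map_poly intr (\prod_(d <- divisors N) 'Phi_d) : {poly L}) zeta.
    rewrite prod_Cyclotomic // rmorphB rmorph1 /= map_polyXn /root !hornerE.
    by rewrite prim_expr_order // subrr.
  rewrite rmorph_prod root_prod_has => /hasP[d dN Phi_d]; rewrite map_Phi.
  have [<- //|neq_dN] := eqVneq d N.
  move: dN; rewrite -dvdn_divisors // => dN; have d0 := dvdn_gt0 N0 dN.
  have : root (map_poly intr ('X^d - 1 : {poly int}) : {poly L}) zeta.
    rewrite -prod_Cyclotomic // rmorph_prod root_prod_has; apply/hasP.
    by exists d; rewrite // -dvdn_divisors.
  rewrite rmorphB rmorph1 /= map_polyXn /root !hornerE subr_eq0.
  rewrite -(prim_order_dvd prim) => Nd.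
  by case/eqP: neq_dN; apply/eqP; rewrite eqn_dvd dN.
have [p Dp] := polyOver1_map (minPolyOver 1 z).
have : p %= ('Phi_N)^Q.
  apply: (Cyclotomic_irreducible N0).2.
    by rewrite -(size_map_poly (in_alg L0)) -Dp size_minPoly eqSS -lt0n.
  by rewrite -(dvdp_map (in_alg L0)) -Dp minPoly_dvdp // alg_polyOver.
move/eqp_size; rewrite size_map_inj_poly ?rmorph0 //; last exact: intr_inj.
rewrite size_Cyclotomic -(size_map_poly (in_alg L0)) -Dp size_minPoly => -[<-].
by rewrite adjoin_degreeE dimv1 divn1 field_dimS // subvf.
Qed.

(** * Root clusters of products of translates *)

Lemma card_eq_seq (T : choiceType) (s : seq T) (A : set T) : uniq s ->
  (forall x, A x <-> x \in s) -> (A #= `I_(size s))%card.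
Proof.
case: s => [|x0 s'] us As.
  have -> : A = set0 by apply/seteqP; split => [x /As|x []].
  by rewrite /= II0 card_eq0.
set s := x0 :: s' in us As *.
have -> : A = (nth x0 s @` `I_(size s))%classic.
  apply/seteqP; split => x /=.
    by move=> /As xs; exists (index x s); [rewrite -index_mem in xs|rewrite nth_index].
  by case=> i /= lt_i <-; apply/As/mem_nth.
apply: inj_card_eq => i j; rewrite !inE /= => lt_i lt_j /eqP.
by rewrite nth_uniq // => /eqP.
Qed.

Lemma dvdp_prod_coprime (F : fieldType) (I : eqType) (s : seq I) (h : I -> {poly F}) q :
  uniq s -> {in s, forall b, h b %| q} ->
  {in s &, forall b b', b != b' -> coprimep (h b) (h b')} ->
  \prod_(b <- s) h b %| q.
Proof.
elim: s => [|b s IH] /=; first by rewrite big_nil dvd1p.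
case/andP=> bs us dvd cop; rewrite big_cons Gauss_dvdp.
  rewrite dvd ?mem_head // IH // => [b' b's|b1 b2 b1s b2s].
    by rewrite dvd // in_cons b's orbT.
  by apply: cop; rewrite in_cons ?b1s ?b2s orbT.
rewrite big_seq; elim/big_ind: _ => [|u v cu cv|b' b's]; first exact: coprimep1.
  by rewrite coprimepMr cu.
apply: cop; rewrite ?mem_head ?in_cons ?b's ?orbT //.
by apply: contraNneq bs => ->.
Qed.

Lemma comp_XsubC_XaddC (R : comNzRingType) (p : {poly R}) c :
  (p \Po ('X - c%:P)) \Po ('X + c%:P) = p.
Proof. by rewrite -comp_polyA comp_polyB comp_polyX comp_polyC addrK comp_polyXr. Qed.

Lemma comp_XaddC_XsubC (R : comNzRingType) (p : {poly R}) c :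
  (p \Po ('X + c%:P)) \Po ('X - c%:P) = p.
Proof. by rewrite -comp_polyA comp_polyD comp_polyX comp_polyC subrK comp_polyXr. Qed.

Lemma irreducible_comp_XsubC (F : fieldType) (p : {poly F}) c :
  irreducible_poly p -> irreducible_poly (p \Po ('X - c%:P)).
Proof.
case=> sp irr; split=> [|q q1 qp]; first by rewrite size_comp_poly2 ?size_XsubC.
have /irr : q \Po ('X + c%:P) %| p.
  by rewrite -[X in _ %| X](comp_XsubC_XaddC p c) dvdp_comp_poly.
rewrite size_comp_poly2 ?size_XaddC // => /(_ q1) /andP[_ pq].
by rewrite /eqp qp -[X in _ %| X](comp_XaddC_XsubC q c) dvdp_comp_poly.
Qed.

Lemma irreducible_root_dvd (F : fieldType) (E : fieldType) (j : {rmorphism F -> E})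
    (p q : {poly F}) z :
  irreducible_poly p -> root (map_poly j p) z -> root (map_poly j q) z -> p %| q.
Proof.
move=> irr pz qz; apply: irreducible_ncoprime_dvd => //; apply/negP.
by rewrite -(coprimep_map j) => /coprimep_root /(_ pz); rewrite (rootP qz) eqxx.
Qed.

Lemma intr_inj_pchar0 (F : fieldType) : [pchar F] =i pred0 ->
  injective (intr : int -> F).
Proof.
move=> /pcharf0P F0 a b /eqP; rewrite -subr_eq0 -intrB => ab; apply/eqP.
rewrite -subr_eq0; case: (a - b) ab => n; first by rewrite -pmulrn F0.
by rewrite NegzE intrN oppr_eq0 -pmulrn F0.
Qed.

Section Cluster.
Variables (K : fieldType) (Kbar : closedFieldType) (iota : {rmorphism K -> Kbar}).
Variables (L : splittingFieldType K) (j : {rmorphism L -> Kbar}).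
Hypothesis jE : forall x : K, j x%:A = iota x.
Hypothesis ch0 : [pchar K] =i pred0.
Variables (s : seq L) (p : {poly K}).
Hypotheses (us : uniq s) (ps : map_poly (in_alg L) p = \prod_(b <- s) ('X - b%:P)).
Hypothesis s_gen :
  {in s &, forall b b', exists q : {poly K}, b' = (map_poly (in_alg L) q).[b]}.
Hypothesis s_conj : {in s &, forall b b', root (minPoly 1 b) b'}.
Variables (g : {poly int}) (T : seq int).
Hypotheses (g_rigid : rigid L g T) (sg : (2 < size g)%N).
Hypothesis uT : uniq T.
Hypothesis gT : {in T, forall e, g \Po (e *: 'X) = g}.

Local Notation gL := (map_poly intr g : {poly L}).
Local Notation gK := (map_poly intr g : {poly Kbar}).
Let h b := gL \Po ('X - b%:P).

Let g_mon : g \is monic. Proof. by case: g_rigid. Qed.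
Let gL_mon : gL \is monic. Proof. exact: monic_map. Qed.
Let gL_irr : irreducible_poly gL. Proof. by case: g_rigid. Qed.
Let size_gL : size gL = size g.
Proof. by rewrite size_map_poly_id0 // (monicP g_mon) rmorph1 oner_eq0. Qed.

Let map_j_gL : map_poly j gL = gK.
Proof. by rewrite -map_poly_comp; apply: eq_map_poly => x /=; rewrite rmorph_int. Qed.

Let map_j_alg (q : {poly K}) : map_poly j (map_poly (in_alg L) q) = map_poly iota q.
Proof. by rewrite -map_poly_comp; apply: eq_map_poly => x /=; apply: jE. Qed.

(** A root of g has degree at least 2 over L, so 1 and this root are linearly independent over L. *)
Lemma rigid_dvd_linear (a c : L) : gL %| c%:P + a *: 'X -> a = 0 /\ c = 0.
Proof.
have small : (size (c%:P + a *: 'X)%R < size gL)%N.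
  apply: leq_ltn_trans (size_polyD _ _) _; rewrite gtn_max size_gL.
  rewrite (leq_ltn_trans (size_polyC_leq1 _)) ?(ltnW sg) //=.
  by rewrite (leq_ltn_trans (size_scale_leq _ _)) // size_polyX.
have [E _|nz /dvdp_leq] := eqVneq (c%:P + a *: 'X) 0; last first.
  by move/(_ nz); rewrite leqNgt small.
split.
  by have /(congr1 (fun q : {poly L} => q`_1)) := E; rewrite !coefE /= mulr1 add0r.
by have /(congr1 (fun q : {poly L} => q`_0)) := E; rewrite !coefE /= mulr0 addr0.
Qed.

(** If z + c is a conjugate of the root z, rigidity forces z + c = e z, and linear independence
    gives c = 0. Distinct translates of g are therefore coprime. *)
Lemma rigid_translation (c : L) : gL %| gL \Po ('X + c%:P) -> c = 0.
Proof.
case: g_rigid => _ _ /(_ ('X + c%:P)) H /H[e _].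
have -> : 'X + c%:P - e%:~R *: 'X = c%:P + (1 - e%:~R) *: 'X.
  by rewrite scalerBl scale1r addrAC addrC.
by case/rigid_dvd_linear.
Qed.

Definition cluster_poly_ext : {poly L} := \prod_(b <- s) h b.
Local Notation fL := cluster_poly_ext.

Let h_irr b : irreducible_poly (h b). Proof. exact: irreducible_comp_XsubC. Qed.
Let h_size b : size (h b) = size g.
Proof. by rewrite size_comp_poly2 ?size_XsubC. Qed.
Let h_neq0 b : h b != 0.
Proof. by rewrite -size_poly_gt0 h_size (ltn_trans _ sg). Qed.

Lemma gal_root_mem (x : gal_of {:L}) b : b \in s -> x b \in s.
Proof.
rewrite -!root_prod_XsubC -ps => pb.
have -> : map_poly (in_alg L) p = map_poly x (map_poly (in_alg L) p).
  by rewrite -map_poly_comp; apply: eq_map_poly => c /=; rewrite linearZ /= rmorph1.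
by rewrite /root horner_map (rootP pb) rmorph0.
Qed.

Lemma gal_map_h (x : gal_of {:L}) b : map_poly x (h b) = h (x b).
Proof.
rewrite /h map_comp_poly rmorphB /= map_polyX map_polyC /=; congr (_ \Po _).
by rewrite -map_poly_comp; apply: eq_map_poly => c /=; rewrite rmorph_int.
Qed.

(** Galois automorphisms permute [s], hence the factors, because g has integer coefficients. *)
Lemma cluster_poly_descends : exists f : {poly K}, map_poly (in_alg L) f = fL.
Proof.
suff /polyOver1_map[f ->] : fL \is a polyOver 1%VS by exists f.
apply/polyOverP => i; have [x|k ->] := gal_fixed_scalar ch0 (c := fL`_i).
  rewrite -coef_map; suff -> : map_poly x fL = fL by [].
  rewrite /fL rmorph_prod.
  have perm_s : perm_eq [seq x b | b <- s] s.
    apply: uniq_perm => //; first by rewrite map_inj_uniq //; apply: fmorph_inj.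
    apply: (uniq_min_size _ _ _).2; rewrite ?size_map //.
    - by rewrite map_inj_uniq //; apply: fmorph_inj.
    - by move=> _ /mapP[b bs ->]; apply: gal_root_mem.
  rewrite -[RHS](perm_big _ perm_s) /= big_map; apply: eq_bigr => b _.
  exact: gal_map_h.
by rewrite memvZ // mem1v.
Qed.

Lemma coprimep_h b b' : b != b' -> coprimep (h b) (h b').
Proof.
apply: contraNT => /(irreducible_ncoprime_dvd (h_irr b)).
move=> /(dvdp_comp_poly ('X + b%:P)); rewrite /h comp_XsubC_XaddC -comp_polyA.
rewrite comp_polyB comp_polyX comp_polyC -addrA -polyCB => /rigid_translation/eqP.
by rewrite subr_eq0.
Qed.

Variable f : {poly K}.
Hypothesis fE : map_poly (in_alg L) f = fL.
Hypothesis s_gt0 : (0 < size s)%N.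

Lemma size_cluster_poly : size f = ((size g).-1 * size s).+1.
Proof.
rewrite -(size_map_poly (in_alg L)) fE /fL size_prod_seq => [|b _]; last exact: h_neq0.
rewrite (eq_bigr (fun=> size g)) => [|b _]; last exact: h_size.
rewrite big_const_seq count_predT iter_addn_0 subSn; last first.
  by rewrite leq_pmull // (ltn_trans _ sg).
by rewrite -[X in (_ - X)%N]mul1n -mulnBl subn1.
Qed.

Let f_neq0 : f != 0. Proof. by rewrite -size_poly_gt0 size_cluster_poly. Qed.

(** A nonconstant factor over K has a root in [Kbar], hence is divisible over L by one of the
    translates. Being fixed by the Galois group, it is divisible by all of them, and so by their
    product as they are pairwise coprime. *)
Lemma irreducible_cluster_poly : irreducible_poly f.
Proof.
split=> [|q q1 qf].
  rewrite size_cluster_poly ltnS muln_gt0 s_gt0 andbT.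
  by case: (size g) sg => [|[]].
have q0 : q != 0 by apply: contraTneq qf => ->; rewrite dvd0p.
rewrite /eqp qf -(dvdp_map (in_alg L)) fE; set qL := map_poly _ q.
have [y qy] : exists y, root (map_poly iota q) y by apply/closed_rootP; rewrite size_map_poly.
have : root (map_poly j fL) y.
  rewrite -fE map_j_alg; case/dvdpP: qf => r ->; rewrite rmorphM rootM qy orbT //.
rewrite /fL rmorph_prod root_prod_has => /hasP[b bs hy].
have hq : h b %| qL by apply: (irreducible_root_dvd (h_irr b) hy); rewrite map_j_alg.
apply: dvdp_prod_coprime => // [b' b's|b1 b2 _ _]; last exact: coprimep_h.
have [x <-] := gal_transitive ch0 (s_conj bs b's).
have -> : qL = map_poly x qL.
  by rewrite -map_poly_comp; apply: eq_map_poly => c /=; rewrite linearZ /= rmorph1.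
by rewrite -gal_map_h dvdp_map.
Qed.

(** * The cluster of a root gamma = b + z *)

Section Cluster_of_root.
Variables (gamma : Kbar) (b : L).
Hypotheses (bs : b \in s) (h_gamma : root (map_poly j (h b)) gamma).
Let z := gamma - j b.

Lemma map_j_h c x : (map_poly j (h c)).[x] = gK.[x - j c].
Proof.
rewrite /h map_comp_poly map_j_gL horner_comp rmorphB /= map_polyX map_polyC.
by rewrite hornerXsubC.
Qed.

Let gz : root (map_poly j gL) z.
Proof. by rewrite map_j_gL /root -map_j_h; apply: h_gamma. Qed.

Lemma rigid_root (F : {poly L}) : root gK (map_poly j F).[z] ->
  exists2 e, e \in T & (map_poly j F).[z] = e%:~R * z.
Proof.
move=> gF; case: g_rigid => _ _ /(_ F)[|e eT].
  apply: (irreducible_root_dvd gL_irr gz).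
  by rewrite map_comp_poly map_j_gL /root horner_comp.
move=> dvd; exists e => //; apply/eqP; rewrite -subr_eq0; apply/eqP.
have : root (map_poly j (F - e%:~R *: 'X)) z.
  case/dvdpP: dvd => r ->; rewrite rmorphM rootM gz orbT //.
by rewrite rmorphB /= map_polyZ /= map_polyX /root !hornerE rmorph_int => /eqP.
Qed.

Lemma linear_inj (a a' c c' : L) : j c + j a * z = j c' + j a' * z -> a = a' /\ c = c'.
Proof.
move=> E; have [] : a - a' = 0 /\ c - c' = 0; last by move=> /subr0_eq -> /subr0_eq ->.
apply: rigid_dvd_linear; apply: (irreducible_root_dvd gL_irr gz).
rewrite rmorphD /= map_polyZ map_polyC map_polyX /root !hornerE !rmorphB /=.
by rewrite [j (c - _)]rmorphB mulrBl addrACA -opprD E subrr.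
Qed.

(** K(gamma) lies in L(z) = L[z]: a denominator that does not vanish at z is coprime to g and is
    inverted by Bezout. *)
Lemma simple_extension_poly x : simple_extension iota gamma x ->
  exists F : {poly L}, x = (map_poly j F).[z].
Proof.
have shift (q : {poly K}) :
    (map_poly iota q).[gamma] = (map_poly j (map_poly (in_alg L) q \Po ('X + b%:P))).[z].
  rewrite map_comp_poly map_j_alg horner_comp rmorphD /= map_polyX map_polyC.
  by rewrite !hornerE subrK.
case=> u [v [v0 ->]]; rewrite !shift in v0 *.
set U := _ \Po _; set V := _ \Po _ in v0 *.
have : coprimep gL V.
  apply/negPn/negP => /(irreducible_ncoprime_dvd gL_irr) /dvdpP[r Vr].
  by move: v0; rewrite Vr rmorphM hornerM (rootP gz) mulr0 eqxx.
case/Bezout_eq1_coprimepP => -[c e] /= E; exists (U * e).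
have := congr1 (fun q => (map_poly j q).[z]) E.
rewrite /= rmorphD !rmorphM rmorph1 /= !hornerE (rootP gz) mulr0 add0r => E1.
by apply: (canLR (mulfK v0)); rewrite -mulrA E1 mulr1.
Qed.

Lemma root_fE x : root (map_poly iota f) x = has (fun c => root (map_poly j (h c)) x) s.
Proof. by rewrite -map_j_alg fE rmorph_prod root_prod_has. Qed.

(** The element b is the only common root of p and g(gamma - X): for another one c, z + b - c would
    be a root of g in L(z), so b = c by rigidity. The gcd [D], taken over K(gamma), is therefore
    linear and its root lies in K(gamma). *)
Lemma conjugate_in_simple_extension : exists A : {poly K}, j b = (map_poly iota A).[gamma].
Proof.
have f_gamma : root (map_poly iota f) gamma by rewrite root_fE; apply/hasP; exists b.
pose E := SubFieldExtType f_gamma irreducible_cluster_poly.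
pose k : {rmorphism E -> Kbar} := @subfx_inj _ _ iota gamma f.
have kE x : k x%:A = iota x by apply: subfx_inj_base.
pose gamma0 : E := @subfx_root _ _ iota gamma f.
have kg : k gamma0 = gamma by apply: subfx_inj_root.
pose P1 : {poly E} := map_poly (in_alg E) p.
pose P2 : {poly E} := map_poly intr g \Po (gamma0%:P - 'X).
have kP1 : map_poly k P1 = \prod_(c <- s) ('X - (j c)%:P).
  rewrite -map_poly_comp (eq_map_poly kE) -map_j_alg ps rmorph_prod.
  by apply: eq_bigr => c _; rewrite rmorphB /= map_polyX map_polyC.
have kP2 x : (map_poly k P2).[x] = gK.[gamma - x].
  rewrite map_comp_poly horner_comp rmorphB /= map_polyX map_polyC /= !hornerE kg.
  by rewrite -map_poly_comp; congr _.[_]; apply: eq_map_poly => c /=; rewrite rmorph_int.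
pose D := gcdp P1 P2.
have rootD x : root (map_poly k D) x = (x \in [seq j c | c <- s]) && root gK (gamma - x).
  rewrite gcdp_map root_gcd kP1 -(big_map j xpredT (fun c => 'X - c%:P)) root_prod_XsubC.
  by rewrite /root kP2.
have rootDb x : root (map_poly k D) x = (x == j b).
  rewrite rootD; apply/andP/eqP => [[/mapP[c cs ->]] gc|->]; last first.
    by rewrite map_f //; move: gz; rewrite map_j_gL.
  have [|e eT] := @rigid_root ('X + (b - c)%:P).
    rewrite rmorphD /= map_polyX map_polyC !hornerE /=.
    by rewrite [j (_ - _)]rmorphB /z addrA subrK.
  rewrite rmorphD /= map_polyX map_polyC !hornerE => Ee.
  have [_ /eqP] : (1 : L) = e%:~R /\ b - c = 0.
    by apply: linear_inj; rewrite rmorph1 mul1r rmorph0 add0r rmorph_int -Ee addrC.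
  by rewrite subr_eq0 => /eqP ->.
have D_dvd : map_poly k D %| \prod_(c <- [seq j c | c <- s]) ('X - c%:P).
  by rewrite big_map -kP1 dvdp_map dvdp_gcdl.
(* [D] divides a product of distinct linear factors, so having a single root makes it linear and not
   a higher power. *)
have [m Dm] := dvdp_prod_XsubC D_dvd.
set r := mask _ _ in Dm.
have ur : uniq r by rewrite mask_uniq // map_inj_uniq //; apply: fmorph_inj.
have rE x : (x \in r) = (x == j b).
  by rewrite -root_prod_XsubC -(eqp_root Dm) rootDb.
have sr : size r = 1%N.
  have /perm_size -> // : perm_eq r [:: j b].
  by apply: uniq_perm => // x; rewrite rE inE.
have sD : size D = 2.
  by rewrite -(size_map_poly k) (eqp_size Dm) size_prod_XsubC sr.
have D1 : D`_1 != 0.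
  have -> : D`_1 = lead_coef D by rewrite lead_coefE sD.
  by rewrite lead_coef_eq0 -size_poly_gt0 sD.
have := rootDb (j b); rewrite eqxx => /rootP.
rewrite horner_coef size_map_poly sD big_ord_recl big_ord1 !coef_map /= expr0 expr1 mulr1.
move=> E0; have {}E0 : k D`_0 + k D`_1 * j b = 0 := E0.
have kD1 : k D`_1 != 0 by rewrite fmorph_eq0.
have -> : j b = k (- D`_0 / D`_1).
  by rewrite fmorph_div rmorphN (addr0_eq E0) mulrAC mulfV // mul1r.
have [A ->] := subfxEroot f_gamma (irredp_neq0 irreducible_cluster_poly) (- D`_0 / D`_1).
exists A; rewrite -horner_map /= -[subfx_inj _]/(k gamma0) kg -map_poly_comp.
by congr _.[_]; apply: eq_map_poly => c /=; rewrite -kE.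
Qed.

(** A root x in K(gamma) is a value at z of a polynomial over L, and x - c is a root of g for some
    conjugate c, so x = c + e z by rigidity. Conversely b, hence c and z = gamma - b, lie in
    K(gamma). Linear independence and characteristic 0 make these sums distinct. *)
Lemma root_cluster_card : (root_cluster iota f gamma #= `I_(size s * size T))%card.
Proof.
pose r := [seq j c + e%:~R * z | c <- s, e <- T].
have -> : (size s * size T)%N = size r by rewrite size_allpairs.
apply: card_eq_seq => [|x].
  apply: allpairs_uniq => //.
  move=> [c e] [c' e'] /allpairsP[[c1 e1] /= [c1s e1T [-> ->]]].
  move=> /allpairsP[[c2 e2] /= [c2s e2T [-> ->]]] E.
  have [] := @linear_inj e1%:~R e2%:~R c1 c2; first by rewrite !rmorph_int.
  move=> Ee ->; congr (_, _).
  exact: (intr_inj_pchar0 (pchar_alg L ch0) Ee).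
split.
  case=> fx /simple_extension_poly[F Dx].
  have := fx : root _ _; rewrite root_fE => /hasP[c cs hc].
  have [|e eT] := @rigid_root (F - c%:P).
    by rewrite rmorphB /= map_polyC !hornerE -Dx /root -map_j_h.
  rewrite rmorphB /= map_polyC !hornerE -Dx => Ee.
  by apply/allpairsP; exists (c, e); split=> //=; rewrite -Ee addrC subrK.
case/allpairsP => -[c e] /= [cs eT ->]; split.
  rewrite /= root_fE; apply/hasP; exists c => //.
  rewrite /root map_j_h addrC addKr; move: gz; rewrite map_j_gL => /rootP <-.
  rewrite -{2}(gT eT) map_comp_poly map_polyZ map_polyX horner_comp /=.
  by rewrite !hornerE.
have [A DA] := conjugate_in_simple_extension.
have [q Dq] := s_gen bs cs.
(* At gamma, A has value b, so q(A) has value c = q(b) and X - A has value z. *)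
exists (q \Po A + e%:~R *: ('X - A)), 1.
rewrite rmorph1 hornerE oner_eq0 divr1; split=> //.
rewrite rmorphD /= map_comp_poly map_polyZ rmorphB /= map_polyX rmorph_int !hornerE.
rewrite horner_comp -!DA Dq -map_j_alg horner_map //.
Qed.

End Cluster_of_root.

Lemma root_clusters_card : root_clusters_have_size iota f (size s * size T).
Proof.
move=> gamma; rewrite -map_j_alg fE rmorph_prod root_prod_has => /hasP[b bs hb].
exact: root_cluster_card bs hb.
Qed.

End Cluster.

(** * Existence of polynomials with prescribed cluster size *)

Lemma number_field_extension_generator (K : fieldExtType rat) (L : fieldExtType K) :
  exists (rho : {rmorphism rat -> L}) (theta : L) (P : {poly int}),
  [/\ forall x, exists p, x = (map_poly rho p).[theta],
      forall p, (map_poly rho p).[theta] = 0 <-> map_poly intr P %| p,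
      (1 < size P)%N &
      coprimep (map_poly intr P : {poly rat}) (map_poly intr P)^`()].
Proof.
have [theta [P HP]] := number_field_generator (baseFieldType L).
pose rho : {rmorphism rat -> baseFieldType L} := in_alg (baseFieldType L).
by exists rho, theta, P.
Qed.

Lemma exists_root_clusters_size (K : fieldExtType rat) (Kbar : closedFieldType)
    (iota : {rmorphism K -> Kbar}) (d n : nat) (T : seq int) :
  (0 < d)%N -> uniq T ->
  (forall L : fieldExtType K, exists g : {poly int},
    [/\ size g = n.+1, {in T, forall e, g \Po (e *: 'X) = g} & rigid L g T]) ->
  (1 < n)%N ->
  exists f : {poly K}, [/\ irreducible_poly f, size f = (n * d).+1 &
    root_clusters_have_size iota f (d * size T)].
Proof.
move=> d0 uT exg n1.
have ch0 : [pchar K] =i pred0 by apply: pchar_alg; apply: pchar_num.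
pose m := \dim {:K}; have m0 : (0 < m)%N by apply: (adim_gt0 (fullv : {aspace K})).
have dm0 : (0 < d * m)%N by rewrite muln_gt0 d0.
(* With N the square of d m, where m = [K : Q], the number d m divides the totient of N, which
   divides [L : K] m; so d divides [L : K]. *)
have [|L [j [zeta [prim gen jE]]]] := @cyclotomic_extension _ _ iota ((d * m) ^ 2) ch0.
  by rewrite expn_gt0 dm0.
have d_dvd : (d %| \dim {:L})%N.
  rewrite -(dvdn_pmul2r m0); apply: dvdn_trans (dvdn_totient_sqr dm0) _.
  exact: dvdn_totient_dim prim.
have [s [p [us ss ps s_gen s_conj]]] :=
  abelian_galois_element ch0 (cyclotomic_abelian prim gen) d_dvd.
have [g [sg gT g_rigid]] := exg L.
have sg2 : (2 < size g)%N by rewrite sg.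
have [f fE] := cluster_poly_descends ch0 us ps g.
have s0 : (0 < size s)%N by rewrite ss.
exists f; split.
- exact: (irreducible_cluster_poly jE ch0 us s_conj g_rigid sg2 fE s0).
- by rewrite (size_cluster_poly g_rigid sg2 fE) sg ss.
rewrite -ss.
exact: (root_clusters_card jE ch0 us ps s_gen s_conj g_rigid sg2 uT gT fE s0).
Qed.

Theorem theorem2 :
  (forall (K : fieldExtType rat) (Kbar : closedFieldType)
          (iota : {rmorphism K -> Kbar}) (n d : nat),
      algebraic_closure iota -> (3 <= n)%N -> (1 <= d)%N ->
      exists f : {poly K},
        irreducible_poly f /\
        size f = (n * d).+1 /\
        root_clusters_have_size iota f d) /\
  (forall (Qbar : closedFieldType) (iota : {rmorphism rat -> Qbar}) (d : nat),
      algebraic_closure iota -> (0 < d)%N -> ~~ odd d ->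
      exists f : {poly rat},
        irreducible_poly f /\
        size f = (2 * d).+1 /\
        root_clusters_have_size iota f d).
Proof.
split=> [K Kbar iota n d _ n3 d1|Qbar iota d _ d0 even_d].
  have [|//||f [irr sf cf]] := @exists_root_clusters_size K Kbar iota d n [:: 1] d1.
  - by [].
  - move=> L; have [rho [theta [P [gen min sP sepP]]]] := number_field_extension_generator L.
    have [g [sg g_rigid]] := exists_rigid1 gen min sP sepP n3.
    by exists g; split=> // e; rewrite inE => /eqP ->; rewrite scale1r comp_polyXr.
  - exact: ltnW.
  by exists f; rewrite muln1 in cf.
(* A Galois extension of degree d/2 and a quartic with two conjugates in L(z) give degree 4 (d/2) =
   2 d and clusters of size 2 (d/2) = d; the base field is Q viewed as an extension of itself. *)
have d2 : (d = d./2 * 2)%N by rewrite muln2 even_halfK.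
have d20 : (0 < d./2)%N by case: d d0 even_d {d2} => [|[]].
have [|||f [irr sf cf]] :=
  @exists_root_clusters_size (rat^o : fieldExtType rat) Qbar iota d./2 4 [:: 1; -1] d20.
- by [].
- move=> L; have [rho [theta [P [gen min sP sepP]]]] := number_field_extension_generator L.
  have [g [sg gN g_rigid]] := exists_rigid2 gen min sP sepP.
  exists g; split=> // e; rewrite !inE => /orP[] /eqP ->; first by rewrite scale1r comp_polyXr.
  by rewrite scaleN1r.
- by [].
exists f; split=> //; split; first by rewrite sf; lia.
by move: cf; rewrite /= -d2.
Qed.
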